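(* Let $p\ge3$ be odd, $q$ a primitive $p$-th root of unity, with $q^{1/2}$ chosen so that $(q^{1/2})^p=-1$. For the duality pairing between $U_q(e(1,1))$ and $A(E_q(1,1))$ described in the context one has, for $n,m,k,n',m',k'\in\{0,\dots,p-1\}$ and $t,s,t',s'\in\mathbb N=\{0,1,2,\dots\}$, $$\langle P_+^tP_-^sp_+^np_-^m\kappa^k,\ z_+^{t'}z_-^{s'}\eta_+^{n'}\eta_-^{m'}\zeta(k')\rangle=i^{\,n+m+t+s}\,q^{\frac{n-m}2-nm}\,t!\,s!\,[n]!\,[m]!\ \delta_{nn'}\,\delta_{mm'}\,\delta_{tt'}\,\delta_{ss'}\,\delta_{k+t+s,\,k'} ,$$ which implies that the universal $T$-matrix in (the formal completion of) $U_q(e(1,1))\otimes A(E_q(1,1))$ has the form $$T=e^{-iP_+\otimes z_+-iP_-\otimes z_-}\;e_+^{\,i\epsilon_+\otimes\eta_+}\;e_-^{\,i\epsilon_-\otimes\eta_-}\;D(\kappa,\delta),$$ where $\epsilon_\pm=-q^{\mp\frac12}p_\pm\kappa^{-1}$ and $$D(\kappa,\delta)=\frac1p\sum_{m,k=0}^{p-1}q^{-mk}\kappa^m\otimes\delta^k .$$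
   Context: Notation: $[n]=\frac{q^n-q^{-n}}{q-q^{-1}}$, $[n]!=[1]\cdots[n]$, $[0]!=1$; $\delta$ with two subscripts is the Kronecker symbol, while $\delta$ without subscripts is an algebra generator. $A(E_q(1,1))$: generated by $\eta_\pm,\delta$ and (functions of) $z_\pm$, where $z_\pm$ commute with everything and $\eta_-\eta_+=q^2\eta_+\eta_-$, $\eta_\pm\delta=q^2\delta\eta_\pm$, $\delta^p=1_A$, $\eta_\pm^p=0$; coproduct $\Delta(\eta_\pm)=\eta_\pm\otimes1+\delta^{\pm1}\otimes\eta_\pm$, $\Delta(\delta)=\delta\otimes\delta$, $$\Delta(z_\pm)=z_\pm\otimes1+1\otimes z_\pm+(-1)^{\frac{p+1}2}\sum_{n=1}^{p-1}\frac{q^{\pm n^2}}{[p-n]![n]!}\eta_\pm^{p-n}\delta^{\pm n}\otimes\eta_\pm^n ,$$ counit $\varepsilon(\delta)=1$, $\varepsilon(\eta_\pm)=\varepsilon(z_\pm)=0$. For the pairing one uses the Hopf subalgebra polynomial in $z_\pm$, with linear basis $z_+^tz_-^s\eta_+^n\eta_-^m\zeta(k)$ ($t,s\in\mathbb N$; $n,m,k\in\{0,\dots,p-1\}$), where $\zeta(k)=\frac1p\sum_{j=0}^{p-1}q^{-jk}\delta^j$, which is periodic: $\zeta(k+pj)=\zeta(k)$ for $j\in\mathbb Z$. $U_q(e(1,1))$: generated by $p_\pm,\kappa$ with $p_+p_-=p_-p_+$, $p_\pm\kappa=q^{\mp1}\kappa p_\pm$, $\kappa^p=1_U$; coproduct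 $\Delta(p_\pm)=p_\pm\otimes\kappa+\kappa^{-1}\otimes p_\pm$, $\Delta(\kappa)=\kappa\otimes\kappa$; counit $\varepsilon(p_\pm)=0$, $\varepsilon(\kappa)=1$. Put $P_\pm=p_\pm^p$; then $\Delta(P_\pm)=P_\pm\otimes1+1\otimes P_\pm$. A linear basis is $P_+^tP_-^sp_+^np_-^m\kappa^k$ ($t,s\in\mathbb N$; $n,m,k\in\{0,\dots,p-1\}$). Pairing: the Hopf duality pairing determined by $\langle\kappa^j,\delta^{j'}\rangle=q^{jj'}$ (so $\langle\kappa^n,\zeta(m)\rangle=\delta_{nm}$ for $n,m\in\{0,\dots,p-1\}$), $\langle p_\pm^n,\eta_\pm^m\rangle=i^nq^{\pm n/2}[n]!\,\delta_{nm}$ for $n,m\in\{0,\dots,p-1\}$, and $\langle P_\pm^n,z_\pm^m\rangle=i^nn!\,\delta_{nm}$ for $n,m\in\mathbb N$, with all other pairings of a generator ($p_\pm$ or $\kappa$) with a generator ($\eta_\pm$, $\delta$ or $z_\pm$) equal to $0$. Universal $T$-matrix: if $\{x_a\}$ and $\{X^a\}$ are dual linear bases of $A(E_q(1,1))$ (polynomial in $z_\pm$) and $U_q(e(1,1))$, $\langle X^b,x_a\rangle=\delta_{ab}$, then $T=\sum_aX^a\otimes x_a$, a formal (infinite in the powers of $P_\pm\otimes z_\pm$) sum. The ordinary exponential is the formal power series, and the cut-off $q$-exponentials are $e_\pm^x=\sum_{m=0}^{p-1}\frac{q^{\pm m(m-1)/2}}{[m]!}x^m$. Products in $T$ are taken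 in the tensor product algebra.
   Formalization: The printed factor δ_{k+t+s,k'} is false (P_+ is primitive, so ⟨P_+, z_+ζ(1)⟩ = i·ε(ζ(1)) = 0, while the printed value is i); it is replaced by the condition k+n+m ≡ k' (mod p), which holds for all indices. *)

(* Defs.v *)
From HB Require Import structures.
From mathcomp Require Import all_boot all_order all_algebra.
From mathcomp Require Import generic_quotient.
From mathcomp Require Import boolp.

Set Implicit Arguments.
Unset Strict Implicit.
Unset Printing Implicit Defensive.

Import GRing.Theory.
Local Open Scope ring_scope.
Local Open Scope quotient_scope.

Inductive expr (K G : Type) : Type :=
| Gen of G
| Cst of K
| Add of expr K G & expr K G
| Mul of expr K G & expr K G.
Arguments Gen {K G} g%_R : rename.
Arguments Cst {K G} c%_R : rename.
Arguments Add {K G}.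
Arguments Mul {K G}.

Declare Scope expr_scope.
Delimit Scope expr_scope with X.
Bind Scope expr_scope with expr.
Notation "x + y" := (Add x y) : expr_scope.
Notation "x * y" := (Mul x y) : expr_scope.
Definition Exp (K : nzRingType) G (x : expr K G) (n : nat) : expr K G :=
  iter n (Mul x) (Cst 1).
Notation "x ^+ n" := (Exp x n) : expr_scope.

(* The least congruence containing rel and the axioms of unital associative   *)
(* K-algebras; the quotient of expr K G by it is K<G>/(rel).                  *)
Inductive cong (K : comNzRingType) (G : Type)
    (rel : expr K G -> expr K G -> Prop) : expr K G -> expr K G -> Prop :=
| cong_rel x y : rel x y -> cong rel x y
| cong_refl x : cong rel x x
| cong_sym x y : cong rel x y -> cong rel y x
| cong_trans x y z : cong rel x y -> cong rel y z -> cong rel x z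
| cong_add x x' y y' : cong rel x x' -> cong rel y y' ->
    cong rel (x + y)%X (x' + y')%X
| cong_mul x x' y y' : cong rel x x' -> cong rel y y' ->
    cong rel (x * y)%X (x' * y')%X
| cong_addA x y z : cong rel (x + (y + z))%X (x + y + z)%X
| cong_addC x y : cong rel (x + y)%X (y + x)%X
| cong_add0 x : cong rel (Cst 0 + x)%X x
| cong_addN x : cong rel (Cst (-1) * x + x)%X (Cst 0)
| cong_mulA x y z : cong rel (x * (y * z))%X (x * y * z)%X
| cong_mul1l x : cong rel (Cst 1 * x)%X x
| cong_mul1r x : cong rel (x * Cst 1)%X x
| cong_mulDl x y z : cong rel ((x + y) * z)%X (x * z + y * z)%X
| cong_mulDr x y z : cong rel (x * (y + z))%X (x * y + x * z)%X
| cong_CstD c d : cong rel (Cst (c + d)) (Cst c + Cst d)%X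
| cong_CstM c d : cong rel (Cst (c * d)) (Cst c * Cst d)%X
| cong_CstC c x : cong rel (Cst c * x)%X (x * Cst c)%X.

HB.instance Definition _ (K G : Type) := gen_eqMixin (expr K G).
HB.instance Definition _ (K G : Type) := gen_choiceMixin (expr K G).

Section Presented.
Variables (K : comNzRingType) (G : Type) (rel : expr K G -> expr K G -> Prop).

Definition congb (x y : expr K G) : bool := `[< cong rel x y >].

Lemma congb_equiv : equiv_class_of congb.
Proof.
split=> [x|x y|y x z]; first exact/asboolP/cong_refl.
- by apply/asboolP/asboolP; exact: cong_sym.
- by move=> /asboolP xy /asboolP yz; apply/asboolP; exact: cong_trans xy yz.
Qed.

Canonical cong_equiv := EquivRelPack congb_equiv.

Definition presented := {eq_quot cong_equiv}.
HB.instance Definition _ := Choice.on presented.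

Definition class (x : expr K G) : presented := \pi_{eq_quot cong_equiv} x.
Definition rep (u : presented) : expr K G := @repr _ {eq_quot cong_equiv} u.

Lemma repK u : class (rep u) = u. Proof. exact: reprK. Qed.

Lemma classP x y : class x = class y <-> cong rel x y.
Proof.
split=> [/eqmodP/asboolP //|h]; exact/eqmodP/asboolP.
Qed.

Lemma rep_class x : cong rel (rep (class x)) x.
Proof. by apply/classP; rewrite repK. Qed.

Definition padd (u v : presented) := class (rep u + rep v).
Definition pmul (u v : presented) := class (rep u * rep v).
Definition popp (u : presented) := class (Cst (-1) * rep u).
Definition pscale (c : K) (u : presented) := class (Cst c * rep u).

Lemma paddE x y : padd (class x) (class y) = class (x + y).
Proof. by apply/classP; apply: cong_add; exact: rep_class. Qed.
Lemma pmulE x y : pmul (class x) (class y) = class (x * y).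
Proof. by apply/classP; apply: cong_mul; exact: rep_class. Qed.
Lemma poppE x : popp (class x) = class (Cst (-1) * x).
Proof. by apply/classP; apply: cong_mul; [exact: cong_refl|exact: rep_class]. Qed.
Lemma pscaleE c x : pscale c (class x) = class (Cst c * x).
Proof. by apply/classP; apply: cong_mul; [exact: cong_refl|exact: rep_class]. Qed.

Lemma presentedW (P : presented -> Prop) :
  (forall x, P (class x)) -> forall u, P u.
Proof. by move=> h u; rewrite -(repK u). Qed.

Lemma paddA : associative padd.
Proof.
elim/presentedW=> x; elim/presentedW=> y; elim/presentedW=> z.
by rewrite !paddE; apply/classP; exact: cong_addA.
Qed.
Lemma paddC : commutative padd.
Proof.
elim/presentedW=> x; elim/presentedW=> y.
by rewrite !paddE; apply/classP; exact: cong_addC.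
Qed.
Lemma padd0 : left_id (class (Cst 0)) padd.
Proof. by elim/presentedW=> x; rewrite paddE; apply/classP; exact: cong_add0. Qed.
Lemma paddN : left_inverse (class (Cst 0)) popp padd.
Proof.
by elim/presentedW=> x; rewrite poppE paddE; apply/classP; exact: cong_addN.
Qed.

HB.instance Definition _ := GRing.isZmodule.Build presented paddA paddC padd0 paddN.

Lemma pmulA : associative pmul.
Proof.
elim/presentedW=> x; elim/presentedW=> y; elim/presentedW=> z.
by rewrite !pmulE; apply/classP; exact: cong_mulA.
Qed.
Lemma pmul1l : left_id (class (Cst 1)) pmul.
Proof. by elim/presentedW=> x; rewrite pmulE; apply/classP; exact: cong_mul1l. Qed.
Lemma pmul1r : right_id (class (Cst 1)) pmul.
Proof. by elim/presentedW=> x; rewrite pmulE; apply/classP; exact: cong_mul1r. Qed.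
Lemma pmulDl : left_distributive pmul padd.
Proof.
elim/presentedW=> x; elim/presentedW=> y; elim/presentedW=> z.
by rewrite !(paddE, pmulE); apply/classP; exact: cong_mulDl.
Qed.
Lemma pmulDr : right_distributive pmul padd.
Proof.
elim/presentedW=> x; elim/presentedW=> y; elim/presentedW=> z.
by rewrite !(paddE, pmulE); apply/classP; exact: cong_mulDr.
Qed.

HB.instance Definition _ :=
  GRing.Zmodule_isPzRing.Build presented pmulA pmul1l pmul1r pmulDl pmulDr.

Lemma pscaleA c d u : pscale c (pscale d u) = pscale (c * d) u.
Proof.
elim/presentedW: u => x; rewrite !pscaleE; apply/classP.
apply: cong_trans (cong_mulA _ _ _ _) _.
by apply: cong_mul (cong_refl _ _); apply: cong_sym; exact: cong_CstM.
Qed.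
Lemma pscale1 : left_id 1 pscale.
Proof. by elim/presentedW=> x; rewrite pscaleE; apply/classP; exact: cong_mul1l. Qed.
Lemma pscaleDr : right_distributive pscale padd.
Proof.
move=> c; elim/presentedW=> x; elim/presentedW=> y.
by rewrite !(paddE, pscaleE); apply/classP; exact: cong_mulDr.
Qed.
Lemma pscaleDl u : {morph pscale^~ u : c d / c + d >-> padd c d}.
Proof.
elim/presentedW: u => x c d; rewrite !pscaleE paddE; apply/classP.
apply: cong_trans (cong_mulDl _ _ _ _).
by apply: cong_mul (cong_refl _ _); exact: cong_CstD.
Qed.

HB.instance Definition _ :=
  GRing.Zmodule_isLmodule.Build K presented pscaleA pscale1 pscaleDr pscaleDl.

(* MathComp's algType requires 1 != 0, which an algebra given by generators   *)
(* and relations need not satisfy a priori: presented is only equipped with   *)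
(* its ring and module structures, linked by the next two lemmas.             *)
Lemma pscaleAl c (u v : presented) : c *: (u * v) = (c *: u) * v.
Proof.
elim/presentedW: u => x; elim/presentedW: v => y.
rewrite /GRing.mul/= /GRing.scale/= !(pmulE, pscaleE); apply/classP.
exact: cong_mulA.
Qed.
Lemma pscaleAr c (u v : presented) : c *: (u * v) = u * (c *: v).
Proof.
elim/presentedW: u => x; elim/presentedW: v => y.
rewrite /GRing.mul/= /GRing.scale/= !(pmulE, pscaleE); apply/classP.
apply: cong_trans (cong_mulA _ _ _ _) _.
apply: cong_trans (cong_mul (cong_CstC _ _ _) (cong_refl _ _)) _.
exact/cong_sym/cong_mulA.
Qed.

Definition gen (g : G) : presented := class (Gen g).

End Presented.

(* The tensor product of two K-algebras: the algebra on the symbols a (x) b   *)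
(* subject to K-bilinearity, 1 (x) 1 = 1 and                                  *)
(* (a (x) b)(a' (x) b') = aa' (x) bb'.                                        *)
Section Tensor.
Variables (K : comNzRingType) (G1 G2 : Type).
Variables (rel1 : expr K G1 -> expr K G1 -> Prop).
Variables (rel2 : expr K G2 -> expr K G2 -> Prop).
Local Notation A := (presented rel1).
Local Notation B := (presented rel2).

Inductive tensor_rel : expr K (A * B) -> expr K (A * B) -> Prop :=
| tensor_Dl a a' b :
    tensor_rel (Gen (a + a', b)) (Gen (a, b) + Gen (a', b))%X
| tensor_Dr a b b' :
    tensor_rel (Gen (a, b + b')) (Gen (a, b) + Gen (a, b'))%X
| tensor_Zl c a b : tensor_rel (Gen (c *: a, b)) (Cst c * Gen (a, b))%X
| tensor_Zr c a b : tensor_rel (Gen (a, c *: b)) (Cst c * Gen (a, b))%X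
| tensor_1 : tensor_rel (Gen (1, 1)) (Cst 1)
| tensor_M a a' b b' :
    tensor_rel (Gen (a, b) * Gen (a', b'))%X (Gen (a * a', b * b')).

Definition tens (a : A) (b : B) : presented tensor_rel := gen tensor_rel (a, b).

End Tensor.

Notation tensor rel1 rel2 := (presented (@tensor_rel _ _ _ rel1 rel2)).
Notation "a ⊗ b" := (tens a b) (at level 38, left associativity) : ring_scope.

Definition alg_morphism (K : comNzRingType) (G1 G2 : Type)
    (rel1 : expr K G1 -> expr K G1 -> Prop)
    (rel2 : expr K G2 -> expr K G2 -> Prop)
    (f : presented rel1 -> presented rel2) : Prop :=
  linear f /\ monoid_morphism f.

(* <,> is a pairing of the bialgebras (U, DU, eU) and (A, DA, eA):            *)
(*   <XY, a> = <X (x) Y, DA a>   <X, ab> = <DU X, a (x) b>                    *)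
(*   <1, a> = eA a               <X, 1> = eU X.                               *)
(* The coproducts are expanded, as in Sweedler's notation, into any finite    *)
(* sum of pure tensors. Compatibility with the antipodes is automatic.        *)
Record hopf_pairing (K : comNzRingType) (GU GA : Type)
    (relU : expr K GU -> expr K GU -> Prop)
    (relA : expr K GA -> expr K GA -> Prop)
    (DU : presented relU -> tensor relU relU) (eU : presented relU -> K)
    (DA : presented relA -> tensor relA relA) (eA : presented relA -> K)
    (pair : presented relU -> presented relA -> K) : Prop := {
  pair_linearl : forall a c X Y, pair (c *: X + Y) a = c * pair X a + pair Y a;
  pair_linearr : forall X c a b, pair X (c *: a + b) = c * pair X a + pair X b;
  pair_mull : forall X Y a (s : seq (presented relA * presented relA)),
    DA a = \sum_(u <- s) u.1 ⊗ u.2 ->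
    pair (X * Y) a = \sum_(u <- s) pair X u.1 * pair Y u.2;
  pair_mulr : forall X a b (s : seq (presented relU * presented relU)),
    DU X = \sum_(u <- s) u.1 ⊗ u.2 ->
    pair X (a * b) = \sum_(u <- s) pair u.1 a * pair u.2 b;
  pair_1l : forall a, pair 1 a = eA a;
  pair_1r : forall X, pair X 1 = eU X
}.

Definition linear_basis (K : comNzRingType) (V : lmodType K) (I : eqType)
    (x : I -> V) : Prop :=
  (forall (s : seq I) (c : I -> K), uniq s ->
     \sum_(i <- s) c i *: x i = 0 -> forall i, i \in s -> c i = 0) /\
  (forall v : V, exists (s : seq I) (c : I -> K), v = \sum_(i <- s) c i *: x i).

Definition dual_bases (K : comNzRingType) (U A : lmodType K)
    (pair : U -> A -> K) (I : eqType) (X : I -> U) (x : I -> A) : Prop :=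
  [/\ linear_basis X, linear_basis x & forall a b, pair (X b) (x a) = (a == b)%:R].

Inductive ideal_gen (R : pzRingType) (S : R -> Prop) : R -> Prop :=
| ideal_mul x s y : S s -> ideal_gen S (x * s * y)
| ideal_0 : ideal_gen S 0
| ideal_add u v : ideal_gen S u -> ideal_gen S v -> ideal_gen S (u + v).

Fixpoint ideal_exp (R : pzRingType) (J : R -> Prop) (N : nat) : R -> Prop :=
  if N is N'.+1 then
    ideal_gen (fun w => exists u v, [/\ ideal_exp J N' u, J v & w = u * v])
  else fun _ => True.

(* In the J-adic completion of R, the family w is (unconditionally) summable  *)
(* and its sum is the limit of the Cauchy sequence v.                         *)
Definition adic_sum (R : pzRingType) (J : R -> Prop) (I : eqType)
    (w : I -> R) (v : nat -> R) : Prop :=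
  forall N, exists (S0 : seq I) (L0 : nat), forall (S : seq I) (L : nat),
    uniq S -> {subset S0 <= S} -> (L0 <= L)%N ->
    ideal_exp J N (\sum_(i <- S) w i - v L).

Section QuantumGroup.
Variables (C : numClosedFieldType) (p : nat) (q : C).

Definition qnum (n : nat) : C := (q ^+ n - q ^- n) / (q - q^-1).
Definition qfact (n : nat) : C := \prod_(1 <= j < n.+1) qnum j.

(* Signs +, - are encoded by the booleans true, false; pm e c = c^(+-1).      *)
Definition pm (e : bool) (c : C) : C := if e then c else c^-1.

Inductive gensU := Gp of bool | Gkappa.

Inductive Uq_rel : expr C gensU -> expr C gensU -> Prop :=
| Uq_rel_pp : Uq_rel (Gen (Gp true) * Gen (Gp false))%X
                 (Gen (Gp false) * Gen (Gp true))%X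
| Uq_rel_pk e : Uq_rel (Gen (Gp e) * Gen Gkappa)%X
                   (Cst (pm e q)^-1 * (Gen Gkappa * Gen (Gp e)))%X
| Uq_rel_kp : Uq_rel (Gen Gkappa ^+ p)%X (Cst 1).

Inductive gensA := Geta of bool | Gdelta | Gz of bool.

Inductive Aq_rel : expr C gensA -> expr C gensA -> Prop :=
| Aq_rel_z e g : Aq_rel (Gen (Gz e) * Gen g)%X (Gen g * Gen (Gz e))%X
| Aq_rel_ee : Aq_rel (Gen (Geta false) * Gen (Geta true))%X
                 (Cst (q ^+ 2) * (Gen (Geta true) * Gen (Geta false)))%X
| Aq_rel_ed e : Aq_rel (Gen (Geta e) * Gen Gdelta)%X
                   (Cst (q ^+ 2) * (Gen Gdelta * Gen (Geta e)))%X
| Aq_rel_dp : Aq_rel (Gen Gdelta ^+ p)%X (Cst 1)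
| Aq_rel_ep e : Aq_rel (Gen (Geta e) ^+ p)%X (Cst 0).

Definition Uq := presented Uq_rel.
Definition Aq := presented Aq_rel.

Definition pp (e : bool) : Uq := gen Uq_rel (Gp e).
Definition kappa : Uq := gen Uq_rel Gkappa.
(* kappa ^+ p = 1 and delta ^+ p = 1, so the inverses are the (p-1)-st powers *)
Definition kappaV : Uq := kappa ^+ p.-1.
Definition PP (e : bool) : Uq := pp e ^+ p.

Definition eta (e : bool) : Aq := gen Aq_rel (Geta e).
Definition delta : Aq := gen Aq_rel Gdelta.
Definition deltaV : Aq := delta ^+ p.-1.
Definition deltapm (e : bool) : Aq := if e then delta else deltaV.
Definition z (e : bool) : Aq := gen Aq_rel (Gz e).
Definition zeta (k : nat) : Aq :=
  p%:R^-1 *: \sum_(j < p) q ^- (j * k) *: delta ^+ j.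

Record Uq_bialgebra (DU : Uq -> tensor Uq_rel Uq_rel) (eU : Uq -> C) : Prop := {
  DU_morph : alg_morphism DU;
  DU_p : forall e, DU (pp e) = pp e ⊗ kappa + kappaV ⊗ pp e;
  DU_kappa : DU kappa = kappa ⊗ kappa;
  eU_morph : linear_for *%R eU /\ monoid_morphism eU;
  eU_p : forall e, eU (pp e) = 0;
  eU_kappa : eU kappa = 1
}.

Record Aq_bialgebra (DA : Aq -> tensor Aq_rel Aq_rel) (eA : Aq -> C) : Prop := {
  DA_morph : alg_morphism DA;
  DA_eta : forall e, DA (eta e) = eta e ⊗ 1 + deltapm e ⊗ eta e;
  DA_delta : DA delta = delta ⊗ delta;
  DA_z : forall e, DA (z e) = z e ⊗ 1 + 1 ⊗ z e +
    (-1) ^+ (p.+1)./2 *: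
      \sum_(1 <= n < p)
        (pm e (q ^+ (n ^ 2)) / (qfact (p - n) * qfact n)) *:
          ((eta e ^+ (p - n) * deltapm e ^+ n) ⊗ (eta e ^+ n));
  eA_morph : linear_for *%R eA /\ monoid_morphism eA;
  eA_delta : eA delta = 1;
  eA_eta : forall e, eA (eta e) = 0;
  eA_z : forall e, eA (z e) = 0
}.

(* The values determining the pairing; qh stands for q^(1/2).                 *)
Record pairing_values (qh : C) (pair : Uq -> Aq -> C) : Prop := {
  pair_kd : forall j j', pair (kappa ^+ j) (delta ^+ j') = q ^+ (j * j');
  pair_pe : forall e n m, (n < p)%N -> (m < p)%N ->
    pair (pp e ^+ n) (eta e ^+ m) =
      'i ^+ n * pm e qh ^+ n * qfact n * (n == m)%:R;
  pair_Pz : forall e n m,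
    pair (PP e ^+ n) (z e ^+ m) = 'i ^+ n * n`!%:R * (n == m)%:R;
  pair_pe' : forall e, pair (pp e) (eta (~~ e)) = 0;
  pair_pd : forall e, pair (pp e) delta = 0;
  pair_pz : forall e e', pair (pp e) (z e') = 0;
  pair_ke : forall e, pair kappa (eta e) = 0;
  pair_kz : forall e, pair kappa (z e) = 0
}.

Definition UA := tensor Uq_rel Aq_rel.

(* The ideal of Uq (x) Aq along which formal sums are completed. All four     *)
(* sign combinations are taken because dual bases may mix z_+ and z_-.        *)
Definition Pz_ideal : UA -> Prop :=
  ideal_gen (fun w : UA => exists e e', w = PP e ⊗ z e').

(* T, represented by a Cauchy sequence in the completion, is the sum of       *)
(* X^a (x) x_a for every pair of dual bases, and dual bases exist.            *)
Definition is_universal_T (pair : Uq -> Aq -> C) (T : nat -> UA) : Prop :=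
  (exists (I : eqType) (X : I -> Uq) (x : I -> Aq), dual_bases pair X x) /\
  (forall (I : eqType) (X : I -> Uq) (x : I -> Aq), dual_bases pair X x ->
     adic_sum Pz_ideal (fun a => X a ⊗ x a) T).

(* Partial sums of the exponential series.                                    *)
Definition exp_partial (L : nat) (w : UA) : UA :=
  \sum_(l < L) (l`!%:R^-1 : C) *: w ^+ l.

Definition cutoff_exp (e : bool) (w : UA) : UA :=
  \sum_(m < p) (pm e (q ^+ 'C(m, 2)) / qfact m) *: w ^+ m.

Definition epsilon (qh : C) (e : bool) : Uq := - (pm e qh)^-1 *: (pp e * kappaV).

Definition Dmat : UA :=
  p%:R^-1 *: \sum_(m < p) \sum_(k < p) q ^- (m * k) *: (kappa ^+ m ⊗ delta ^+ k).

End QuantumGroup.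

(* Main.v *)
Require Import Defs.
From mathcomp Require Import all_boot all_order all_algebra ring.
Import GRing.Theory Num.Theory.
Local Open Scope ring_scope.

Set Implicit Arguments.
Unset Strict Implicit.
Unset Printing Implicit Defensive.

(** Translation by p_e acts on A as a kappa-skew derivation, modulo the radical
    of the pairing. Put [mon e W = z_e^(W / p) eta_e^(W mod p)]: since
    eta_e^p = 0, p_e maps [mon e W] to a multiple of
    [mon e (W - 1) delta^(+-1)], so that p_e^N pairs to zero with [mon e W]
    unless N = W. The powers of delta produced on the way account for the
    factor q^(-nm) and for the shift by n + m in the index of zeta. Both
    monomial families span, hence they are dual bases up to scalars, and the
    L-th partial product for T is exactly the part t + s < L of their canonical
    element. For other dual bases, the canonical elements are compared modulo
    J^K through the projections onto the spans of the finitely many monomials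
    with t + s < K: the error is a sum of tensors of elements of the two
    complements, which lie in J^K. *)

(** * Predicates closed under linear combinations *)

Definition linear_closed_prop (K : nzRingType) (V : lmodType K)
    (P : V -> Prop) : Prop :=
  P 0 /\ forall c u v, P u -> P v -> P (c *: u + v).

Section LinearClosed.
Variables (K : nzRingType) (V : lmodType K) (P : V -> Prop).
Hypothesis lcP : linear_closed_prop P.

Lemma linear_closedD u v : P u -> P v -> P (u + v).
Proof. by move=> Pu Pv; rewrite -[u]scale1r; apply: lcP.2. Qed.

Lemma linear_closedZ c u : P u -> P (c *: u).
Proof. by move=> Pu; rewrite -[_ *: _]addr0; apply: lcP.2 => //; exact: lcP.1. Qed.

Lemma linear_closed_sum (I : eqType) (s : seq I) (F : I -> V) :
  (forall i, i \in s -> P (F i)) -> P (\sum_(i <- s) F i).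
Proof.
elim: s => [|i s ih] h; first by rewrite big_nil; exact: lcP.1.
rewrite big_cons; apply: linear_closedD; first by apply: h; rewrite mem_head.
by apply: ih => j js; apply: h; rewrite inE js orbT.
Qed.

End LinearClosed.

Lemma linear_basis_ind (K : comNzRingType) (V : lmodType K) (I : eqType)
    (x : I -> V) (P : V -> Prop) :
  linear_basis x -> linear_closed_prop P -> (forall i, P (x i)) ->
  forall v, P v.
Proof.
move=> [_ spanx] lcP Px v; have [s [c ->]] := spanx v.
by apply: linear_closed_sum => // i _; apply: linear_closedZ.
Qed.

(** * Presented algebras, their tensor products and ideals *)

Section PresentedTheory.
Variables (K : comNzRingType) (G : Type) (rel : expr K G -> expr K G -> Prop).
Local Notation A := (presented rel).

Lemma presented_scaleM c d (u v : A) : (c *: u) * (d *: v) = (c * d) *: (u * v).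
Proof. by rewrite -pscaleAl -pscaleAr scalerA. Qed.

Lemma presented_exprZ c (u : A) n : (c *: u) ^+ n = c ^+ n *: u ^+ n.
Proof.
elim: n => [|n ih]; first by rewrite !expr0 scale1r.
by rewrite !exprS ih presented_scaleM.
Qed.

Lemma class_rel x y : rel x y -> class rel x = class rel y.
Proof. by move=> xy; apply/classP/cong_rel. Qed.

Lemma class_add x y : class rel (x + y) = class rel x + class rel y.
Proof. by rewrite -paddE. Qed.
Lemma class_mul x y : class rel (x * y) = class rel x * class rel y.
Proof. by rewrite -pmulE. Qed.
Lemma class_cst c : class rel (Cst c) = c *: (1 : A).
Proof.
have -> : c *: (1 : A) = pscale c (class rel (Cst 1)) by [].
by rewrite pscaleE; apply/classP/cong_sym; exact: cong_mul1r.
Qed.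
Lemma class_exp x n : class rel (x ^+ n) = class rel x ^+ n.
Proof.
elim: n => [|n ih]; first by rewrite expr0 [LHS]class_cst scale1r.
by rewrite exprS -ih [LHS]class_mul.
Qed.

(** Writing u as u * 1 and generalising the 1 makes an induction on an expression for u possible: by
    associativity a product x * y acts on the accumulator as x after y, so only generators ever
    multiply from the left. *)
Lemma presented_left_ind (P : A -> Prop) :
  linear_closed_prop P -> P 1 -> (forall g u, P u -> P (gen rel g * u)) ->
  forall u, P u.
Proof.
move=> lcP P1 Pgen u; rewrite -[u]mulr1 -[u]repK.
elim: (rep u) (1 : A) P1 => {u} [g|c|x ihx y ihy|x ihx y ihy] v Pv.
- exact: Pgen.
- by rewrite class_cst -pscaleAl mul1r; apply: linear_closedZ.
- by rewrite class_add mulrDl; apply: linear_closedD => //; [apply: ihx|apply: ihy].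
- by rewrite class_mul -mulrA; apply: ihx; apply: ihy.
Qed.

Lemma skew_commuteXr c (a b : A) n :
  a * b = c *: (b * a) -> a * b ^+ n = c ^+ n *: (b ^+ n * a).
Proof.
move=> ab; elim: n => [|n ih]; first by rewrite !expr0 mulr1 mul1r scale1r.
by rewrite exprSr mulrA ih -pscaleAl -mulrA ab -pscaleAr mulrA scalerA -exprSr.
Qed.

Lemma skew_commuteXl c (a b : A) n :
  a * b = c *: (b * a) -> a ^+ n * b = c ^+ n *: (b * a ^+ n).
Proof.
move=> ab; elim: n => [|n ih]; first by rewrite !expr0 mulr1 mul1r scale1r.
by rewrite exprS -mulrA ih -pscaleAr mulrA ab -pscaleAl -mulrA scalerA -exprSr.
Qed.

Lemma skew_commuteX c (a b : A) m n :
  a * b = c *: (b * a) -> a ^+ m * b ^+ n = c ^+ (m * n) *: (b ^+ n * a ^+ m).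
Proof. by move=> ab; rewrite exprM; apply/skew_commuteXr/skew_commuteXl. Qed.

(** Moving each new factor a to the left across b^n costs c^n, and 0 + 1 + ... + (n - 1) = 'C(n,
    2). *)
Lemma skew_exprM c (a b : A) n :
  b * a = c *: (a * b) -> (a * b) ^+ n = c ^+ 'C(n, 2) *: (a ^+ n * b ^+ n).
Proof.
move=> ba; elim: n => [|n ih]; first by rewrite !expr0 mulr1 scale1r.
rewrite exprSr ih -pscaleAl mulrA -[a ^+ n * _ * a]mulrA.
rewrite (skew_commuteXl n ba) -pscaleAr -pscaleAl scalerA mulrA -exprSr.
by rewrite -mulrA -exprSr binS bin1 exprD.
Qed.

End PresentedTheory.

Section TensTheory.
Variables (K : comNzRingType) (G1 G2 : Type).
Variables (rel1 : expr K G1 -> expr K G1 -> Prop).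
Variables (rel2 : expr K G2 -> expr K G2 -> Prop).
Local Notation A := (presented rel1).
Local Notation B := (presented rel2).
Local Notation T := (tensor rel1 rel2).
Implicit Types (a : A) (b : B).

Lemma tensDl a a' b : (a + a') ⊗ b = a ⊗ b + a' ⊗ b.
Proof. by rewrite -class_add; apply/classP/cong_rel; exact: tensor_Dl. Qed.
Lemma tensDr a b b' : a ⊗ (b + b') = a ⊗ b + a ⊗ b'.
Proof. by rewrite -class_add; apply/classP/cong_rel; exact: tensor_Dr. Qed.
Lemma tensZl c a b : (c *: a) ⊗ b = c *: (a ⊗ b).
Proof.
rewrite -[RHS]mul1r -pscaleAr pscaleAl -class_cst -class_mul.
by apply/classP/cong_rel; exact: tensor_Zl.
Qed.
Lemma tensZr c a b : a ⊗ (c *: b) = c *: (a ⊗ b).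
Proof.
rewrite -[RHS]mul1r -pscaleAr pscaleAl -class_cst -class_mul.
by apply/classP/cong_rel; exact: tensor_Zr.
Qed.
Lemma tens11 : (1 : A) ⊗ (1 : B) = 1.
Proof.
rewrite -[1 in RHS]scale1r -class_cst.
by apply/classP/cong_rel; exact: tensor_1.
Qed.
Lemma tensM a a' b b' : (a ⊗ b) * (a' ⊗ b') = (a * a') ⊗ (b * b').
Proof. by rewrite -class_mul; apply/classP/cong_rel; exact: tensor_M. Qed.
Lemma tens0l b : (0 : A) ⊗ b = 0.
Proof. by rewrite -(scale0r (0 : A)) tensZl scale0r. Qed.
Lemma tens0r a : a ⊗ (0 : B) = 0.
Proof. by rewrite -(scale0r (0 : B)) tensZr scale0r. Qed.
Lemma tensBl a a' b : (a - a') ⊗ b = a ⊗ b - a' ⊗ b.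
Proof. by rewrite tensDl -scaleN1r tensZl scaleN1r. Qed.
Lemma tensBr a b b' : a ⊗ (b - b') = a ⊗ b - a ⊗ b'.
Proof. by rewrite tensDr -scaleN1r tensZr scaleN1r. Qed.
Lemma tens_suml (I : Type) (s : seq I) (F : I -> A) b :
  (\sum_(i <- s) F i) ⊗ b = \sum_(i <- s) F i ⊗ b.
Proof.
apply: (big_morph (fun a => a ⊗ b)); last exact: tens0l.
by move=> *; exact: tensDl.
Qed.
Lemma tens_sumr (I : Type) (s : seq I) a (F : I -> B) :
  a ⊗ (\sum_(i <- s) F i) = \sum_(i <- s) a ⊗ F i.
Proof. by apply: (big_morph (tens a)); [move=> *; exact: tensDr|exact: tens0r]. Qed.
Lemma tensX a b n : (a ⊗ b) ^+ n = (a ^+ n) ⊗ (b ^+ n).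
Proof.
elim: n => [|n ih]; first by rewrite !expr0 tens11.
by rewrite !exprS ih tensM.
Qed.

(** The axioms of [hopf_pairing] speak of coproducts only through finite sums of pure tensors; this
    supplies such an expansion for every [DU X]. *)
Lemma tensor_sum (w : T) :
  exists s : seq (A * B), w = \sum_(u <- s) u.1 ⊗ u.2.
Proof.
have sc c (s : seq (A * B)) :
    c *: (\sum_(u <- s) u.1 ⊗ u.2) =
    \sum_(u <- [seq (c *: u.1, u.2) | u <- s]) u.1 ⊗ u.2.
  by rewrite scaler_sumr big_map; apply: eq_bigr => u _; rewrite tensZl.
elim/presented_left_ind: w => [||[a b] _ [s ->]].
- split; first by exists [::]; rewrite big_nil.
  move=> c _ _ [s ->] [t ->].
  by exists ([seq (c *: u.1, u.2) | u <- s] ++ t); rewrite big_cat sc.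
- by exists [:: (1, 1)]; rewrite big_seq1 tens11.
- exists [seq (a * u.1, b * u.2) | u <- s].
  rewrite mulr_sumr big_map; apply: eq_bigr => u _ /=.
  by rewrite -tensM.
Qed.

End TensTheory.

Section Ideals.
Variable R : pzRingType.
Implicit Types (S J : R -> Prop).

Lemma ideal_genM S x u y : ideal_gen S u -> ideal_gen S (x * u * y).
Proof.
elim=> [x' s y' Ss||v w _ ihv _ ihw].
- by rewrite !mulrA -mulrA; apply: ideal_mul.
- by rewrite mulr0 mul0r; apply: ideal_0.
- by rewrite mulrDr mulrDl; apply: ideal_add.
Qed.

Lemma ideal_genMl S x u : ideal_gen S u -> ideal_gen S (x * u).
Proof. by move=> /(ideal_genM x 1); rewrite mulr1. Qed.
Lemma ideal_genMr S x u : ideal_gen S u -> ideal_gen S (u * x).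
Proof. by move=> /(ideal_genM 1 x); rewrite mul1r. Qed.
Lemma ideal_gen_base S u : S u -> ideal_gen S u.
Proof. by move=> /(ideal_mul 1 ^~ 1); rewrite mulr1 mul1r. Qed.

Lemma ideal_expM J N x u y : ideal_exp J N u -> ideal_exp J N (x * u * y).
Proof. by case: N => //= N; apply: ideal_genM. Qed.
Lemma ideal_expMl J N x u : ideal_exp J N u -> ideal_exp J N (x * u).
Proof. by move=> /(ideal_expM x 1); rewrite mulr1. Qed.
Lemma ideal_expMr J N x u : ideal_exp J N u -> ideal_exp J N (u * x).
Proof. by move=> /(ideal_expM 1 x); rewrite mul1r. Qed.
Lemma ideal_exp0 J N : ideal_exp J N 0.
Proof. by case: N => //= N; apply: ideal_0. Qed.
Lemma ideal_expD J N u v :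
  ideal_exp J N u -> ideal_exp J N v -> ideal_exp J N (u + v).
Proof. by case: N => //= N; apply: ideal_add. Qed.
Lemma ideal_expN J N u : ideal_exp J N u -> ideal_exp J N (- u).
Proof. by rewrite -mulN1r; apply: ideal_expMl. Qed.

(** [ideal_exp] adds its new factor on the right. In a noncommutative ring a factor on the left
    needs this induction: v is absorbed into the J^N part of each generator of J^(N+1). *)
Lemma ideal_expSl S N u v :
  ideal_gen S v -> ideal_exp (ideal_gen S) N u ->
  ideal_exp (ideal_gen S) N.+1 (v * u).
Proof.
elim: N v u => [|N ih] v u Jv /= Ju.
  apply: ideal_gen_base; exists 1, (v * u); split=> //; last by rewrite mul1r.
  exact: ideal_genMr.
elim: Ju => [x _ y [u' [v' [Ju' Jv' ->]]]||u1 u2 _ ih1 _ ih2].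
- rewrite [v * _](_ : _ = 1 * (v * x * u' * v') * y); last first.
    by rewrite mul1r !mulrA.
  apply: ideal_mul; exists (v * x * u'), v'; split=> //.
  by apply: ih => //; apply: ideal_genMr.
- by rewrite mulr0; apply: ideal_0.
- by rewrite mulrDr; apply: ideal_add.
Qed.

Lemma ideal_expX S w N : ideal_gen S w -> ideal_exp (ideal_gen S) N (w ^+ N).
Proof.
by move=> Jw; elim: N => // N ih; rewrite exprS; apply: ideal_expSl.
Qed.

End Ideals.

Lemma ideal_exp_linear_closed (K : comNzRingType) (G : Type)
    (rel : expr K G -> expr K G -> Prop) (J : presented rel -> Prop) N :
  linear_closed_prop (ideal_exp J N).
Proof.
split=> [|c u v Ju Jv]; first exact: ideal_exp0.
apply: ideal_expD => //; rewrite -[u]mul1r pscaleAl.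
exact: ideal_expMl.
Qed.

(** * Dual bases and the canonical element *)

Section Spanned.
Variables (K : comNzRingType) (V : lmodType K) (I : eqType) (X : I -> V).

Lemma sum_delta (S : seq I) (F : I -> V) i :
  uniq S -> \sum_(a <- S) (a == i)%:R *: F a = if i \in S then F i else 0.
Proof.
elim: S => [|j S ih] /=; first by rewrite big_nil.
move=> /andP[jS uS]; rewrite big_cons ih // inE eq_sym.
have [->|_] := eqVneq i j; last by rewrite scale0r add0r.
by rewrite (negbTE jS) scale1r addr0.
Qed.

(** Repeated indices are allowed, so that sums are concatenations of lists; [spanned_family]
    collects equal indices afterwards to reach the form used in [linear_basis]. *)
Definition spanned (v : V) : Prop :=
  exists l : seq (K * I), v = \sum_(u <- l) u.1 *: X u.2.

Lemma spanned_linear_closed : linear_closed_prop spanned.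
Proof.
split=> [|c _ _ [l ->] [l' ->]]; first by exists [::]; rewrite big_nil.
exists ([seq (c * u.1, u.2) | u <- l] ++ l').
rewrite big_cat big_map scaler_sumr; congr (_ + _).
by apply: eq_bigr => u _; rewrite scalerA.
Qed.

Lemma spanned_base i : spanned (X i).
Proof. by exists [:: (1, i)]; rewrite big_seq1 scale1r. Qed.

Lemma spanned_family v : spanned v ->
  exists (s : seq I) (c : I -> K), v = \sum_(i <- s) c i *: X i.
Proof.
case=> l ->; exists (undup [seq u.2 | u <- l]).
exists (fun i => \sum_(u <- l) u.1 * (i == u.2)%:R).
under [RHS]eq_bigr do rewrite scaler_suml.
rewrite exchange_big /=; apply: eq_big_seq => u ul.
under [RHS]eq_bigr do rewrite mulrC -scalerA.
rewrite (sum_delta (fun i => u.1 *: X i)) ?undup_uniq // mem_undup.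
by rewrite map_f.
Qed.

End Spanned.

Lemma presented_spanned (K : comNzRingType) (G : Type)
    (rel : expr K G -> expr K G -> Prop) (I : eqType)
    (X : I -> presented rel) :
  spanned X 1 -> (forall g i, spanned X (gen rel g * X i)) ->
  forall v, spanned X v.
Proof.
move=> X1 Xg; have lcX := spanned_linear_closed X.
apply: presented_left_ind => // g _ [l ->].
rewrite mulr_sumr; apply: linear_closed_sum => // u _.
by rewrite -pscaleAr; apply: linear_closedZ.
Qed.

Section DualBases.
Variables (K : comNzRingType) (GU GA : Type).
Variables (relU : expr K GU -> expr K GU -> Prop).
Variables (relA : expr K GA -> expr K GA -> Prop).
Local Notation U := (presented relU).
Local Notation A := (presented relA).
Variable pair : U -> A -> K.
Hypothesis pair_linl : forall a c X Y, pair (c *: X + Y) a = c * pair X a + pair Y a.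
Hypothesis pair_linr : forall X c a b, pair X (c *: a + b) = c * pair X a + pair X b.

Lemma pair0l a : pair 0 a = 0.
Proof.
have := pair_linl a (-1) 0 0.
by rewrite scaler0 addr0 mulN1r addNr.
Qed.
Lemma pair0r X : pair X 0 = 0.
Proof.
have := pair_linr X (-1) 0 0.
by rewrite scaler0 addr0 mulN1r addNr.
Qed.
Lemma pairDl X Y a : pair (X + Y) a = pair X a + pair Y a.
Proof. by rewrite -[X]scale1r pair_linl mul1r scale1r. Qed.
Lemma pairDr X a b : pair X (a + b) = pair X a + pair X b.
Proof. by rewrite -[a]scale1r pair_linr mul1r scale1r. Qed.
Lemma pairZl c X a : pair (c *: X) a = c * pair X a.
Proof. by rewrite -[c *: X]addr0 pair_linl pair0l addr0. Qed.
Lemma pairZr c X a : pair X (c *: a) = c * pair X a.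
Proof. by rewrite -[c *: a]addr0 pair_linr pair0r addr0. Qed.
Lemma pair_suml (I : Type) (s : seq I) (F : I -> U) a :
  pair (\sum_(i <- s) F i) a = \sum_(i <- s) pair (F i) a.
Proof. by apply: (big_morph (pair^~ a)); [move=> *; exact: pairDl|exact: pair0l]. Qed.
Lemma pair_sumr (I : Type) (s : seq I) X (F : I -> A) :
  pair X (\sum_(i <- s) F i) = \sum_(i <- s) pair X (F i).
Proof. by apply: (big_morph (pair X)); [move=> *; exact: pairDr|exact: pair0r]. Qed.

Section Expansion.
Variables (I : eqType) (X : I -> U) (x : I -> A).
Hypothesis dualXx : forall a b, pair (X b) (x a) = (a == b)%:R.

(** Independence comes for free: pairing a vanishing combination with the dual element isolates each
    coefficient. Only spanning has to be proved for a concrete pair of families. *)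
Lemma dual_family_bases :
  (forall u, exists (s : seq I) (c : I -> K), u = \sum_(i <- s) c i *: X i) ->
  (forall v, exists (s : seq I) (c : I -> K), v = \sum_(i <- s) c i *: x i) ->
  dual_bases pair X x.
Proof.
move=> spanX spanx; split=> //; split=> // s c us sum0 i iS.
- have /(congr1 (pair^~ (x i))) := sum0.
  rewrite pair_suml pair0l => /esym/=.
  rewrite (eq_bigr (fun j => (j == i)%:R *: (c j : K^o))) => [|j _].
    by rewrite sum_delta // iS.
  by rewrite pairZl dualXx mulrC eq_sym.
- have /(congr1 (pair (X i))) := sum0.
  rewrite pair_sumr pair0r => /esym/=.
  rewrite (eq_bigr (fun j => (j == i)%:R *: (c j : K^o))) => [|j _].
    by rewrite sum_delta // iS.
  by rewrite pairZr dualXx mulrC.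
Qed.

Lemma dual_expandl (s : seq I) (c : I -> K) (S : seq I) u :
  u = \sum_(i <- s) c i *: X i -> uniq S -> {subset s <= S} ->
  \sum_(a <- S) pair u (x a) *: X a = u.
Proof.
move=> -> uS sS.
under eq_bigr do rewrite pair_suml scaler_suml.
rewrite exchange_big /=; apply: eq_big_seq => i /sS iS.
under eq_bigr do rewrite pairZl dualXx mulrC -scalerA.
by rewrite (sum_delta (fun a => c i *: X a)) // iS.
Qed.

Lemma dual_expandr (s : seq I) (c : I -> K) (S : seq I) v :
  v = \sum_(i <- s) c i *: x i -> uniq S -> {subset s <= S} ->
  \sum_(a <- S) pair (X a) v *: x a = v.
Proof.
move=> -> uS sS.
under eq_bigr do rewrite pair_sumr scaler_suml.
rewrite exchange_big /=; apply: eq_big_seq => i /sS iS.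
under eq_bigr do rewrite pairZr dualXx eq_sym mulrC -scalerA.
by rewrite (sum_delta (fun a => c i *: x a)) // iS.
Qed.

(** Finitely many vectors have finite joint support, beyond which their dual expansions are exact.
    This produces the threshold set required by [adic_sum]. *)
Lemma dual_support (us : seq U) (vs : seq A) : dual_bases pair X x ->
  exists S0 : seq I, forall S, uniq S -> {subset S0 <= S} ->
    (forall u, u \in us -> \sum_(a <- S) pair u (x a) *: X a = u) /\
    (forall v, v \in vs -> \sum_(a <- S) pair (X a) v *: x a = v).
Proof.
case=> [[_ spanX] [_ spanx] _].
have [S1 h1] : exists S1 : seq I, forall S, uniq S -> {subset S1 <= S} ->
    forall u, u \in us -> \sum_(a <- S) pair u (x a) *: X a = u.
  elim: us => [|u us [S1 ih]]; first by exists [::].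
  have [s [c def_u]] := spanX u; exists (s ++ S1) => S uS sub w.
  rewrite inE => /predU1P[->|].
    by apply: dual_expandl def_u uS _ => i js; apply: sub; rewrite mem_cat js.
  by apply: ih => // i js; apply: sub; rewrite mem_cat js orbT.
have [S2 h2] : exists S2 : seq I, forall S, uniq S -> {subset S2 <= S} ->
    forall v, v \in vs -> \sum_(a <- S) pair (X a) v *: x a = v.
  elim: vs => [|v vs [S2 ih]]; first by exists [::].
  have [s [c def_v]] := spanx v; exists (s ++ S2) => S uS sub w.
  rewrite inE => /predU1P[->|].
    by apply: dual_expandr def_v uS _ => i js; apply: sub; rewrite mem_cat js.
  by apply: ih => // i js; apply: sub; rewrite mem_cat js orbT.
exists (S1 ++ S2) => S uS sub; split; [apply: h1|apply: h2] => // i iS;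
  by apply: sub; rewrite mem_cat iS ?orbT.
Qed.

End Expansion.

(* With the projections pr and pr' onto the spans of the finite subfamilies   *)
(* of Y and y indexed by B, the difference of the two canonical elements is   *)
(* the sum over S of (1 - pr) X_a (x) (1 - pr') x_a.                          *)
Lemma canonical_element_approx (I J : eqType) (X : I -> U) (x : I -> A)
    (Y : J -> U) (y : J -> A) (B : seq J) (P : tensor relU relA -> Prop) :
  dual_bases pair X x -> dual_bases pair Y y -> uniq B ->
  linear_closed_prop P ->
  (forall b b', b \notin B -> b' \notin B -> P (Y b ⊗ y b')) ->
  exists S0 : seq I, forall S, uniq S -> {subset S0 <= S} ->
    P (\sum_(a <- S) X a ⊗ x a - \sum_(b <- B) Y b ⊗ y b).
Proof.
move=> dXx dYy uB lcP high.
have [_ _ XxE] := dXx; have [bY by_ YyE] := dYy.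
have [S0 hS0] := dual_support XxE [seq Y b | b <- B] [seq y b | b <- B] dXx.
exists S0 => S uS sS; have [eY ey] := hS0 S uS sS => {S0 sS hS0}.
pose pr u := \sum_(b <- B) pair u (y b) *: Y b.
pose pr' v := \sum_(b <- B) pair (Y b) v *: y b.
have prY b : pr (Y b) = if b \in B then Y b else 0.
  by rewrite /pr; under eq_bigr do rewrite YyE; exact: sum_delta.
have pry b : pr' (y b) = if b \in B then y b else 0.
  rewrite /pr'; under eq_bigr do rewrite YyE eq_sym; exact: sum_delta.
have prL c u v : pr (c *: u + v) = c *: pr u + pr v.
  rewrite /pr scaler_sumr -big_split; apply: eq_bigr => b _ /=.
  by rewrite pair_linl scalerDl scalerA.
have prL' c u v : pr' (c *: u + v) = c *: pr' u + pr' v.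
  rewrite /pr' scaler_sumr -big_split; apply: eq_bigr => b _ /=.
  by rewrite pair_linr scalerDl scalerA.
have pr0 : pr 0 = 0 by rewrite /pr big1 // => b _; rewrite pair0l scale0r.
have pr0' : pr' 0 = 0 by rewrite /pr' big1 // => b _; rewrite pair0r scale0r.
(* On the basis Y the linear map u - pr u vanishes for indices in B and is the identity off B, so
   basis induction in one tensor factor, then in the other, reduces to [high]. *)
have highu u b' : b' \notin B -> P ((u - pr u) ⊗ y b').
  move=> b'B; move: u; apply: (linear_basis_ind bY) => [|b].
    split=> [|c u v Pu Pv]; first by rewrite pr0 subr0 tens0l; exact: lcP.1.
    rewrite prL opprD addrACA -scalerBr tensDl tensZl; exact: lcP.2.
  rewrite prY; case: ifPn => bB; last by rewrite subr0; apply: high.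
  by rewrite subrr tens0l; exact: lcP.1.
have highuv u v : P ((u - pr u) ⊗ (v - pr' v)).
  move: v; apply: (linear_basis_ind by_) => [|b].
    split=> [|c v w Pv Pw]; first by rewrite pr0' subr0 tens0r; exact: lcP.1.
    rewrite prL' opprD addrACA -scalerBr tensDr tensZr; exact: lcP.2.
  rewrite pry; case: ifPn => bB; last by rewrite subr0; apply: highu.
  by rewrite subrr tens0r; exact: lcP.1.
have pr_sum' (F : I -> A) (c : I -> K) :
    \sum_(a <- S) c a *: pr' (F a) = pr' (\sum_(a <- S) c a *: F a).
  elim: S {uS eY ey} => [|a s ih]; first by rewrite !big_nil pr0'.
  by rewrite !big_cons ih prL'.
(* Coefficients move across the tensor sign, and the expansions of [y b] and [Y b] over S are exact.
   Hence all three projected sums equal the part over B, and expanding (1 - pr) (x) (1 - pr') leaves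
   exactly the difference wanted. *)
have E1 : \sum_(a <- S) pr (X a) ⊗ x a = \sum_(b <- B) Y b ⊗ y b.
  under eq_bigr do rewrite tens_suml.
  rewrite exchange_big /=; apply: eq_big_seq => b bB.
  under eq_bigr do rewrite tensZl -tensZr.
  by rewrite -tens_sumr ey // map_f.
have E2 : \sum_(a <- S) X a ⊗ pr' (x a) = \sum_(b <- B) Y b ⊗ y b.
  under eq_bigr do rewrite tens_sumr.
  rewrite exchange_big /=; apply: eq_big_seq => b bB.
  under eq_bigr do rewrite tensZr -tensZl.
  by rewrite -tens_suml eY // map_f.
have E3 : \sum_(a <- S) pr (X a) ⊗ pr' (x a) = \sum_(b <- B) Y b ⊗ y b.
  under eq_bigr do rewrite tens_suml.
  rewrite exchange_big /=; apply: eq_big_seq => b bB.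
  under eq_bigr do rewrite tensZl -tensZr.
  by rewrite -tens_sumr pr_sum' ey ?map_f // pry bB.
rewrite (_ : _ - _ = \sum_(a <- S) (X a - pr (X a)) ⊗ (x a - pr' (x a))).
  by apply: linear_closed_sum => // a _; apply: highuv.
under [RHS]eq_bigr do rewrite tensBr !tensBl opprB.
by rewrite !big_split /= !sumrN E1 E2 E3 subrr addr0.
Qed.

End DualBases.

(** * Relations in the two quantum algebras *)

Section Pairing.
Variables (C : numClosedFieldType) (p : nat) (q qh : C).
Hypotheses (p_ge3 : (3 <= p)%N) (p_odd : odd p) (q_prim : p.-primitive_root q).
Local Notation U := (Uq p q).
Local Notation A := (Aq p q).
Local Notation P := (pp p q).
Local Notation kap := (kappa p q).
Local Notation kapV := (kappaV p q).
Local Notation eta := (eta p q).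
Local Notation delta := (delta p q).
Local Notation z := (z p q).

Let p_gt0 : (0 < p)%N. Proof. exact: leq_trans p_ge3. Qed.
Let p_gt1 : (1 < p)%N. Proof. exact: leq_trans p_ge3. Qed.

Lemma qXp : q ^+ p = 1.
Proof. exact: prim_expr_order. Qed.

Lemma root_of_unity_neq0 (x : C) : x ^+ p = 1 -> x != 0.
Proof.
apply: contra_eqN => /eqP ->.
by rewrite expr0n gtn_eqF // eq_sym oner_eq0.
Qed.

Lemma q_neq0 : q != 0.
Proof. exact: root_of_unity_neq0 qXp. Qed.

Lemma expr_pred_order (x : C) : x ^+ p = 1 -> x ^+ p.-1 = x^-1.
Proof.
move=> xp; have x0 := root_of_unity_neq0 xp.
by apply: (mulfI x0); rewrite -exprS prednK // xp divff.
Qed.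

Lemma pm_expp e : pm e q ^+ p = 1.
Proof. by case: e; rewrite /= ?exprVn qXp ?invr1. Qed.

Lemma pm_neq0 e (x : C) : x != 0 -> pm e x != 0.
Proof. by case: e; rewrite /= ?invr_eq0. Qed.

(** If q^k = q^(-k) then q^(2k) = 1, so p divides 2k and, p being odd, p divides k. This is applied
    to k = j for the numerator and k = 1 for the denominator. *)
Lemma qnum_neq0 j : (0 < j < p)%N -> qnum q j != 0.
Proof.
have q2j k : (0 < k < p)%N -> q ^+ k - q ^- k != 0.
  move=> /andP[k0 kp]; rewrite subr_eq0; apply: contraTneq k0 => qk.
  have : q ^+ k.*2 = 1.
    by rewrite -addnn exprD {2}qk divff // expf_neq0 // q_neq0.
  move/eqP; rewrite -(prim_order_dvd q_prim) -muln2 Gauss_dvdl ?coprimen2 //.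
  by move=> /dvdn_leq; case: k kp {qk} => // k; rewrite ltnNge => /negP h /(_ isT).
move=> hj; rewrite /qnum mulf_neq0 ?q2j // invr_neq0 //.
by have := q2j 1%N; rewrite !expr1; apply.
Qed.

Lemma qfact_neq0 n : (n < p)%N -> qfact q n != 0.
Proof.
move=> np; rewrite /qfact prodf_seq_neq0; apply/allP => j.
rewrite mem_index_iota ltnS => /andP[j0 jn] /=.
by rewrite qnum_neq0 // j0 (leq_ltn_trans jn).
Qed.

Lemma pk_comm e : P e * kap = (pm e q)^-1 *: (kap * P e).
Proof.
by have := class_rel (Uq_rel_pk p q e); rewrite !class_mul class_cst -pscaleAl mul1r.
Qed.

Lemma kp_comm e : kap * P e = pm e q *: (P e * kap).
Proof.
by rewrite pk_comm scalerA divff ?scale1r // pm_neq0 // q_neq0.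
Qed.

Lemma pp_comm e e' : P e * P e' = P e' * P e.
Proof.
have pm_comm : P true * P false = P false * P true.
  by have := class_rel (Uq_rel_pp p q); rewrite !class_mul.
by case: e e' => [] [].
Qed.

Lemma kappaXp : kap ^+ p = 1.
Proof.
by have := class_rel (Uq_rel_kp p q); rewrite class_exp class_cst scale1r.
Qed.

Lemma kappaX_mod k : kap ^+ (k %% p) = kap ^+ k.
Proof. exact: expr_mod kappaXp. Qed.

Lemma kV_comm e : kapV * P e = (pm e q)^-1 *: (P e * kapV).
Proof.
by rewrite /kappaV (skew_commuteXl _ (kp_comm e)) expr_pred_order // pm_expp.
Qed.

Lemma z_central e (u : A) : z e * u = u * z e.
Proof.
elim/presented_left_ind: u => [|| g u ih].
- split=> [|c u v hu hv]; first by rewrite mulr0 mul0r.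
  by rewrite mulrDr mulrDl -pscaleAr hu hv pscaleAl.
- by rewrite mulr1 mul1r.
- rewrite -[RHS]mulrA -ih !mulrA; congr (_ * _).
  by have := class_rel (Aq_rel_z p q e g); rewrite !class_mul.
Qed.

Lemma eta_comm : eta false * eta true = q ^+ 2 *: (eta true * eta false).
Proof.
by have := class_rel (Aq_rel_ee p q); rewrite !class_mul class_cst -pscaleAl mul1r.
Qed.

Lemma eta_delta_comm e : eta e * delta = q ^+ 2 *: (delta * eta e).
Proof.
by have := class_rel (Aq_rel_ed p q e); rewrite !class_mul class_cst -pscaleAl mul1r.
Qed.

Lemma delta_eta_comm e : delta * eta e = q ^- 2 *: (eta e * delta).
Proof.
by rewrite eta_delta_comm scalerA mulVf ?scale1r // expf_neq0 // q_neq0.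
Qed.

Lemma deltaXp : delta ^+ p = 1.
Proof.
by have := class_rel (Aq_rel_dp p q); rewrite class_exp class_cst scale1r.
Qed.

Lemma etaXp e : eta e ^+ p = 0.
Proof.
by have := class_rel (Aq_rel_ep p q e); rewrite class_exp class_cst scale0r.
Qed.

(** The exponent +1 or -1 of delta in the coproduct of eta_e, with -1 represented by p - 1 so that
    all exponents are natural numbers. *)
Definition dexp (e : bool) : nat := if e then 1%N else p.-1.

Lemma deltapmE e : deltapm p q e = delta ^+ dexp e.
Proof. by case: e. Qed.

Definition mon (e : bool) (W : nat) : A := z e ^+ (W %/ p) * eta e ^+ (W %% p).

Lemma mon0 e : mon e 0 = 1.
Proof. by rewrite /mon div0n mod0n mulr1. Qed.

Lemma monE e t n : (n < p)%N -> mon e (t * p + n) = z e ^+ t * eta e ^+ n.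
Proof.
by move=> np; rewrite /mon divnMDl // modnMDl divn_small // addn0 modn_small.
Qed.

(** * Action of the generators on monomials *)

Variables (DU : U -> tensor (Uq_rel p q) (Uq_rel p q)) (eU : U -> C).
Variables (DA : A -> tensor (Aq_rel p q) (Aq_rel p q)) (eA : A -> C).
Hypotheses (U_bialg : Uq_bialgebra DU eU) (A_bialg : Aq_bialgebra DA eA).
Variable pair : U -> A -> C.
Hypothesis pair_hopf : hopf_pairing DU eU DA eA pair.
Hypothesis pair_val : pairing_values qh pair.

Let pl := pair_linearl pair_hopf.
Let pr := pair_linearr pair_hopf.

(* [act Y a b]: modulo the right radical of the pairing, b is the left        *)
(* translate of a by Y, i.e. the sum of the a_(1) <Y, a_(2)>.                 *)
Definition act (Y : U) (a b : A) := forall X, pair (X * Y) a = pair X b.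

Lemma act_coproduct Y a s : DA a = \sum_(u <- s) u.1 ⊗ u.2 ->
  act Y a (\sum_(u <- s) pair Y u.2 *: u.1).
Proof.
move=> Da X; rewrite (pair_mull pair_hopf X Y Da) (pair_sumr pr).
by apply: eq_bigr => u _; rewrite (pairZr pr) mulrC.
Qed.

Lemma act_pair Y a b : act Y a b -> pair Y a = eA b.
Proof. by move=> Yab; rewrite -[Y]mul1r Yab (pair_1l pair_hopf). Qed.

Lemma act_comp X Y a b c : act Y a b -> act X b c -> act (X * Y) a c.
Proof. by move=> Yab Xbc Z; rewrite mulrA Yab Xbc. Qed.

Lemma act_one Y : act Y 1 (eU Y *: (1 : A)).
Proof.
move=> X; rewrite (pairZr pr) !(pair_1r pair_hopf).
by have [_ [_ ->]] := eU_morph U_bialg; rewrite mulrC.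
Qed.

Lemma actZ Y a b c : act Y a b -> act Y (c *: a) (c *: b).
Proof. by move=> Yab X; rewrite !(pairZr pr) Yab. Qed.

Lemma actX Y a c n : act Y a (c *: a) -> act (Y ^+ n) a (c ^+ n *: a).
Proof.
move=> Ya; elim: n => [|n ih]; first by move=> X; rewrite expr0 mulr1 scale1r.
by rewrite exprSr; apply: act_comp Ya _; rewrite [c ^+ _]exprS -scalerA; apply: actZ.
Qed.

(** kappa is group-like, so it acts multiplicatively. *)
Lemma act_kappaM a a' b b' :
  act kap a a' -> act kap b b' -> act kap (a * b) (a' * b').
Proof.
move=> ka kb X; have [s Xs] := tensor_sum (DU X).
have [_ [_ DM]] := DU_morph U_bialg.
have Xk : DU (X * kap) =
    \sum_(u <- [seq (u.1 * kap, u.2 * kap) | u <- s]) u.1 ⊗ u.2.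
  rewrite DM (DU_kappa U_bialg) Xs mulr_suml big_map.
  by apply: eq_bigr => u _; rewrite tensM.
rewrite (pair_mulr pair_hopf _ _ Xk) (pair_mulr pair_hopf _ _ Xs) big_map.
by apply: eq_bigr => u _ /=; rewrite ka kb.
Qed.

(** The skew Leibniz rule, read off from the two terms of the coproduct of p_e. *)
Lemma act_pM e a a' a'' b b' b'' :
  act kapV a a'' -> act kap b b'' -> act (P e) a a' -> act (P e) b b' ->
  act (P e) (a * b) (a' * b'' + a'' * b').
Proof.
move=> ka kb pa pb X; have [s Xs] := tensor_sum (DU X).
have [_ [_ DM]] := DU_morph U_bialg.
have Xp : DU (X * P e) = \sum_(u <- [seq (u.1 * P e, u.2 * kap) | u <- s] ++
    [seq (u.1 * kapV, u.2 * P e) | u <- s]) u.1 ⊗ u.2.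
  rewrite DM (DU_p U_bialg) Xs mulrDr !mulr_suml big_cat !big_map.
  by congr (_ + _); apply: eq_bigr => u _; rewrite tensM.
rewrite (pair_mulr pair_hopf _ _ Xp) (pairDr pr) !(pair_mulr pair_hopf _ _ Xs).
rewrite big_cat !big_map; congr (_ + _); apply: eq_bigr => u _ /=.
  by rewrite pa kb.
by rewrite ka pb.
Qed.

Lemma act_eq Y a b b' : act Y a b -> b = b' -> act Y a b'.
Proof. by move=> h <-. Qed.

Lemma act_kappa_eta e : act kap (eta e) (eta e).
Proof.
have De : DA (eta e) =
    \sum_(u <- [:: (eta e, 1); (deltapm p q e, eta e)]) u.1 ⊗ u.2.
  by rewrite big_cons big_seq1 (DA_eta A_bialg).
apply: act_eq (act_coproduct kap De) _.
rewrite big_cons big_seq1 /= (pair_ke pair_val) scale0r addr0.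
by rewrite (pair_1r pair_hopf) (eU_kappa U_bialg) scale1r.
Qed.

Lemma act_kappa_delta : act kap delta (q *: delta).
Proof.
have Dd : DA delta = \sum_(u <- [:: (delta, delta)]) u.1 ⊗ u.2.
  by rewrite big_seq1 (DA_delta A_bialg).
apply: act_eq (act_coproduct kap Dd) _; rewrite big_seq1 /=.
by have := pair_kd pair_val 1 1; rewrite !expr1 => ->.
Qed.

Lemma act_kappaX a c n : act kap a (c *: a) -> act kap (a ^+ n) (c ^+ n *: a ^+ n).
Proof.
move=> ka; elim: n => [|n ih].
  by rewrite !expr0; apply: act_eq (act_one _) _; rewrite (eU_kappa U_bialg).
by rewrite !exprS -presented_scaleM; apply: act_kappaM.
Qed.

Lemma act_kappa_fixX a n : act kap a a -> act kap (a ^+ n) (a ^+ n).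
Proof.
move=> ka; have k1 : act kap a (1 *: a) by rewrite scale1r.
by apply: act_eq (act_kappaX n k1) _; rewrite expr1n scale1r.
Qed.

Lemma act_kappa_deltaX n : act kap (delta ^+ n) (q ^+ n *: delta ^+ n).
Proof. exact/act_kappaX/act_kappa_delta. Qed.

Lemma act_kappaV_fix a : act kap a a -> act kapV a a.
Proof.
move=> ka; have k1 : act kap a (1 *: a) by rewrite scale1r.
by apply: act_eq (actX p.-1 k1) _; rewrite expr1n scale1r.
Qed.

Lemma act_p_delta e : act (P e) delta 0.
Proof.
have Dd : DA delta = \sum_(u <- [:: (delta, delta)]) u.1 ⊗ u.2.
  by rewrite big_seq1 (DA_delta A_bialg).
apply: act_eq (act_coproduct (P e) Dd) _; rewrite big_seq1 /=.
by rewrite (pair_pd pair_val) scale0r.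
Qed.

Lemma act_p_eta e e' : act (P e) (eta e')
  ((if e == e' then pair (P e) (eta e) else 0) *: delta ^+ dexp e').
Proof.
have De : DA (eta e') =
    \sum_(u <- [:: (eta e', 1); (deltapm p q e', eta e')]) u.1 ⊗ u.2.
  by rewrite big_cons big_seq1 (DA_eta A_bialg).
apply: act_eq (act_coproduct (P e) De) _.
rewrite big_cons big_seq1 /= (pair_1r pair_hopf) (eU_p U_bialg) scale0r add0r.
rewrite -deltapmE; case: eqVneq => [-> //|ne].
by rewrite (_ : e' = ~~ e) ?(pair_pe' pair_val) //; case: e e' ne {De} => [] [].
Qed.

Lemma act_p_eta_neq e : act (P e) (eta (~~ e)) 0.
Proof.
apply: act_eq (act_p_eta e (~~ e)) _.
by rewrite (_ : e == _ = false) ?scale0r //; case: (e).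
Qed.

Lemma act_p0X e a n : act kap a a -> act (P e) a 0 -> act (P e) (a ^+ n) 0.
Proof.
move=> ka pa; elim: n => [|n ih].
  by rewrite expr0; apply: act_eq (act_one _) _; rewrite (eU_p U_bialg) scale0r.
rewrite exprS; apply: act_eq.
  apply: act_pM pa ih; first exact: act_kappaV_fix ka.
  exact: act_kappa_fixX.
by rewrite mul0r mulr0 addr0.
Qed.

Lemma act_p_deltaX e n : act (P e) (delta ^+ n) 0.
Proof.
elim: n => [|n ih].
  by rewrite expr0; apply: act_eq (act_one _) _; rewrite (eU_p U_bialg) scale0r.
rewrite exprS; apply: act_eq.
  apply: act_pM (act_p_delta e) ih; first exact: actX act_kappa_delta.
  exact: act_kappa_deltaX.
by rewrite mul0r mulr0 addr0.
Qed.

(** Up to the value of the pairing on generators, the q-integer 1 + r + ... + r^(n-1) with r =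
    q^(-2) for e = + and r = q^2 for e = -, because q^(-2(p-1)) = q^2. *)
Definition eta_coef e n :=
  pair (P e) (eta e) * \sum_(k < n) q ^- 2 ^+ (dexp e * k).

(** By the Leibniz rule, p_e on the leading factor eta_e leaves a power of delta on the left; moving
    it to the right past the other factors gives the next term of the q-integer. *)
Lemma act_p_etaX e n :
  act (P e) (eta e ^+ n.+1) (eta_coef e n.+1 *: (eta e ^+ n * delta ^+ dexp e)).
Proof.
elim: n => [|n ih].
  rewrite /eta_coef big_ord1 muln0 expr0 mul1r mulr1.
  by apply: act_eq (act_p_eta e e) _; rewrite eqxx.
rewrite [eta e ^+ n.+2]exprS; apply: act_eq.
  apply: act_pM (act_p_eta e e) ih.
    exact/act_kappaV_fix/act_kappa_eta.
  exact/act_kappa_fixX/act_kappa_eta.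
rewrite eqxx -pscaleAl (skew_commuteX _ _ (delta_eta_comm e)) -pscaleAr.
rewrite mulrA -exprS scalerA -scalerDl; congr (_ *: _).
by rewrite /eta_coef [in RHS]big_ord_recr /= mulrDr addrC.
Qed.

Lemma eA1 : eA 1 = 1.
Proof. by have [_ []] := eA_morph A_bialg. Qed.
Lemma eAM a b : eA (a * b) = eA a * eA b.
Proof. by have [_ []] := eA_morph A_bialg. Qed.
Lemma eAX a n : eA (a ^+ n) = eA a ^+ n.
Proof. by elim: n => [|n ih]; rewrite ?eA1 // !exprS eAM ih. Qed.
Lemma eAZ c a : eA (c *: a) = c * eA a.
Proof. by rewrite -!(pair_1l pair_hopf) (pairZr pr). Qed.

Lemma eA0 : eA 0 = 0.
Proof. by rewrite -(scale0r (1 : A)) eAZ mul0r. Qed.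

Lemma eA_eta_delta e n m : eA (eta e ^+ n * delta ^+ m) = (n == 0)%:R.
Proof.
by rewrite eAM !eAX (eA_eta A_bialg) (eA_delta A_bialg) expr1n mulr1 expr0n.
Qed.

Definition DA_z_coef e n : C := (-1) ^+ (p.+1)./2 *
  (pm e (q ^+ (n ^ 2)) / (qfact q (p - n) * qfact q n)).

Lemma DA_z_sum e :
  DA (z e) = \sum_(u <- [:: (z e, 1); (1, z e)] ++
    [seq (DA_z_coef e n *: (eta e ^+ (p - n) * deltapm p q e ^+ n), eta e ^+ n)
      | n <- index_iota 1 p]) u.1 ⊗ u.2.
Proof.
rewrite (DA_z A_bialg) big_cat big_cons big_seq1 big_map scaler_sumr /=.
by congr (_ + _); apply: eq_bigr => n _; rewrite tensZl scalerA.
Qed.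

Lemma act_kappa_z e : act kap (z e) (z e).
Proof.
apply: act_eq (act_coproduct kap (DA_z_sum e)) _.
rewrite big_cat big_cons big_seq1 big_map /= (pair_kz pair_val) scale0r addr0.
rewrite (pair_1r pair_hopf) (eU_kappa U_bialg) scale1r big_nat.
rewrite big1 ?addr0 // => n /andP[n0 _].
rewrite (act_pair (act_kappa_fixX n (act_kappa_eta e))) eAX (eA_eta A_bialg).
by rewrite expr0n gtn_eqF // scale0r.
Qed.

Lemma act_p_z_neq e : act (P e) (z (~~ e)) 0.
Proof.
apply: act_eq (act_coproduct (P e) (DA_z_sum (~~ e))) _.
rewrite big_cat big_cons big_seq1 big_map /= (pair_pz pair_val) scale0r addr0.
rewrite (pair_1r pair_hopf) (eU_p U_bialg) scale0r add0r.
rewrite big1 // => n _.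
rewrite (act_pair (act_p0X n (act_kappa_eta _) (act_p_eta_neq e))).
by rewrite eA0 scale0r.
Qed.

Definition z_coef e := pair (P e) (eta e) * DA_z_coef e 1.

(** In the sum in Delta(z_e) only n = 1 contributes. For n > 1, p_e sends eta_e^n to a multiple of
    eta_e^(n-1) delta^(+-1), which the counit kills, so p_e pairs to 0 with eta_e^n. *)
Lemma act_p_z e :
  act (P e) (z e) (z_coef e *: (eta e ^+ p.-1 * delta ^+ dexp e)).
Proof.
apply: act_eq (act_coproduct (P e) (DA_z_sum e)) _.
rewrite big_cat big_cons big_seq1 big_map /= (pair_pz pair_val) scale0r addr0.
rewrite (pair_1r pair_hopf) (eU_p U_bialg) scale0r add0r.
rewrite big_ltn // expr1 scalerA subn1 deltapmE expr1.
rewrite big_nat big1 ?addr0 // => n /andP[n1 _].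
case: n n1 => // -[//|n] _.
by rewrite (act_pair (act_p_etaX e n.+1)) eAZ eA_eta_delta mulr0 scale0r.
Qed.

Lemma act_p_zX e n : act (P e) (z e ^+ n)
  (n%:R * z_coef e *: (z e ^+ n.-1 * (eta e ^+ p.-1 * delta ^+ dexp e))).
Proof.
elim: n => [|n ih].
  rewrite expr0 mul0r scale0r.
  by apply: act_eq (act_one _) _; rewrite (eU_p U_bialg) scale0r.
rewrite exprS; apply: act_eq.
  apply: act_pM (act_p_z e) ih; first exact/act_kappaV_fix/act_kappa_z.
  exact/act_kappa_fixX/act_kappa_z.
have zC u : u * z e = z e * u by rewrite z_central.
rewrite -pscaleAl (commrX n (zC _)) -pscaleAr [z e * (_ * _)]mulrA -exprS.
case: n {ih} => [|n].
  by rewrite mulr0n mul0r scale0r addr0 mulr1n mul1r.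
by rewrite -scalerDl /= [in RHS]mulrS mulrDl mul1r.
Qed.

(** At multiples of p a factor z_e is lowered, otherwise a factor eta_e. The first branch gives 0 at
    W = 0, where [W.-1] is truncated. *)
Definition mon_coef e W :=
  if (W %% p == 0)%N then (W %/ p)%:R * z_coef e else eta_coef e (W %% p).

Lemma act_p_mon e W :
  act (P e) (mon e W) (mon_coef e W *: (mon e W.-1 * delta ^+ dexp e)).
Proof.
rewrite /mon_coef {1}/mon; have np := ltn_pmod W p_gt0.
case: eqVneq => [W0|].
  rewrite W0 expr0 mulr1; apply: act_eq (act_p_zX e _) _.
  have Wt : W = (W %/ p * p)%N by rewrite {1}(divn_eq W p) W0 addn0.
  move: Wt; case: (W %/ p)%N => [_|t Wt]; first by rewrite mulr0n mul0r !scale0r.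
  have -> : W.-1 = (t * p + p.-1)%N.
    by rewrite Wt mulSn addnC -!subn1 addnBA.
  by rewrite monE ?prednK // mulrA.
rewrite -lt0n => n0.
have -> : W.-1 = (W %/ p * p + (W %% p).-1)%N.
  by rewrite {1}(divn_eq W p) -!subn1 addnBA.
move: n0 np; case: (W %% p)%N => // n _ np /=; rewrite monE 1?ltnW //.
apply: act_eq.
  apply: act_pM (act_p_zX e _) (act_p_etaX e n).
    exact/act_kappaV_fix/act_kappa_fixX/act_kappa_z.
  exact/act_kappa_fixX/act_kappa_eta.
(* The term in which p_e meets the power of z_e contains eta_e^(p-1) eta_e^(n+1) and vanishes since
   eta_e^p = 0. *)
rewrite -pscaleAl -!mulrA (skew_commuteX _ _ (delta_eta_comm e)) -!pscaleAr.
rewrite [_ * (_ * delta ^+ _)]mulrA -exprD addnS -addSn prednK // exprD etaXp.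
by rewrite !(mul0r, mulr0) !scaler0 add0r.
Qed.

Lemma act_kappa_mon e W : act kap (mon e W) (mon e W).
Proof.
apply: act_kappaM; first exact/act_kappa_fixX/act_kappa_z.
exact/act_kappa_fixX/act_kappa_eta.
Qed.

Lemma act_p_mon_neq e W : act (P e) (mon (~~ e) W) 0.
Proof.
apply: act_eq.
  apply: act_pM.
  - exact/act_kappaV_fix/act_kappa_fixX/act_kappa_z.
  - exact/act_kappa_fixX/act_kappa_eta.
  - by apply: act_p0X; [exact: act_kappa_z|exact: act_p_z_neq].
  - by apply: act_p0X; [exact: act_kappa_eta|exact: act_p_eta_neq].
by rewrite mul0r mulr0 addr0.
Qed.

Lemma eA_mon e W : eA (mon e W) = (W == 0)%:R.
Proof.
rewrite eAM !eAX (eA_eta A_bialg) (eA_z A_bialg) !expr0n -natrM mulnb.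
by rewrite {3}(divn_eq W p) addn_eq0 muln_eq0 (gtn_eqF p_gt0) orbF.
Qed.

(* [actw e Y w a b]: Y acts as a |-> b inside any product g a r whose outer   *)
(* factors are killed by p_e, g being fixed by kappa; an eigenvalue d of      *)
(* kappa on r contributes d^w.                                                *)
Definition actw e Y w a b := forall g r d,
  act (P e) g 0 -> act kap g g -> act (P e) r 0 -> act kap r (d *: r) ->
  act Y (g * (a * r)) (d ^+ w *: (g * (b * r))).

Lemma actw_p e a b : act (P e) a b -> act kap a a -> actw e (P e) 1 a b.
Proof.
move=> pa ka g r d pg kg p_r kr; apply: act_eq.
  apply: act_pM pg (act_pM _ kr pa p_r); first exact: act_kappaV_fix.
    by apply: act_kappaM ka kr.
  exact: act_kappaV_fix.
by rewrite mul0r add0r mulr0 addr0 -!pscaleAr.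
Qed.

(** The delta^j left behind by Y is counted with r when X acts; its kappa-eigenvalue q^j, raised to
    the weight v of X, is the additional scalar. *)
Lemma actw_comp e X Y v w a b b' c j :
  actw e Y w a (c *: (b * delta ^+ j)) -> actw e X v b b' ->
  actw e (X * Y) (v + w) a (c * q ^+ (j * v) *: (b' * delta ^+ j)).
Proof.
move=> Ya Xb g r d pg kg p_r kr; apply: act_comp (Ya g r d pg kg p_r kr) _.
apply: act_eq.
  rewrite -pscaleAl -mulrA -pscaleAr; apply/actZ/actZ/(Xb _ _ (q ^+ j * d)) => //.
    apply: act_eq.
      apply: act_pM (act_p_deltaX e j) p_r; last exact: kr.
      exact: actX p.-1 (act_kappa_deltaX j).
    by rewrite mul0r mulr0 addr0.
  apply: act_eq; first exact: act_kappaM (act_kappa_deltaX j) kr.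
  by rewrite presented_scaleM.
rewrite !scalerA -pscaleAl -pscaleAr scalerA -[b' * _ * r]mulrA; congr (_ *: _).
by rewrite exprMn exprD -exprM; ring.
Qed.

(** * Values of the pairing *)

Definition pair_mon e N := pair (P e ^+ N) (mon e N).

Lemma actw_pX e N W : exists c, [/\ (W < N)%N -> c = 0, W = N -> c = pair_mon e N
  & actw e (P e ^+ N) N (mon e W) (c *: (mon e (W - N) * delta ^+ (dexp e * N)))].
Proof.
(* The value of c at W = N is found by testing with g = r = 1, d = 1 and applying the counit; the
   induction only has to track the vanishing for W < N. *)
suff [c [c0 ac]] : exists c, ((W < N)%N -> c = 0) /\
    actw e (P e ^+ N) N (mon e W) (c *: (mon e (W - N) * delta ^+ (dexp e * N))).
  exists c; split=> // WN; rewrite WN in ac; rewrite /pair_mon.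
  have p1 : act (P e) 1 0.
    by apply: act_eq (act_one _) _; rewrite (eU_p U_bialg) scale0r.
  have k1 : act kap 1 1.
    by apply: act_eq (act_one _) _; rewrite (eU_kappa U_bialg) scale1r.
  have k1' : act kap 1 (1 *: (1 : A)) by rewrite scale1r.
  have := act_pair (ac 1 1 1 p1 k1 p1 k1').
  rewrite !(mulr1, mul1r) => ->.
  rewrite expr1n scale1r eAZ eAM eA_mon subnn eqxx eAX (eA_delta A_bialg).
  by rewrite expr1n !mulr1.
elim: N W => [|N ih] W.
  exists 1; split=> // g r d _ _ _ _ X.
  by rewrite !expr0 subn0 muln0 expr0 !(mulr1, scale1r).
have [c [c0 ac]] := ih W.-1.
have := actw_comp (actw_p (act_p_mon e W) (act_kappa_mon e W)) ac.
rewrite addn1 -exprSr -pscaleAl scalerA -[_ * delta ^+ _]mulrA -exprD addnC -mulnS.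
rewrite -subn1 subnAC subn1 -subnS => h.
eexists; split; last exact: h.
(* At W = 0 the predecessor is again 0, and the vanishing comes from [mon_coef e 0] instead of the
   induction hypothesis. *)
case: W c0 {ac h} => [_ _|W c0 /= WN]; first by rewrite /mon_coef mod0n div0n !mul0r.
by rewrite c0 ?mulr0.
Qed.

Lemma pair_mon0 e : pair_mon e 0 = 1.
Proof. by rewrite /pair_mon expr0 mon0 (pair_1l pair_hopf) eA1. Qed.

(** One factor p_e leaves mon e N times delta^(+-1); the N remaining factors then each see the
    kappa-eigenvalue of that power of delta. *)
Lemma pair_monS e N :
  pair_mon e N.+1 = mon_coef e N.+1 * q ^+ (dexp e * N) * pair_mon e N.
Proof.
have p1 : act (P e) 1 0.
  by apply: act_eq (act_one _) _; rewrite (eU_p U_bialg) scale0r.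
have k1 : act kap 1 1.
  by apply: act_eq (act_one _) _; rewrite (eU_kappa U_bialg) scale1r.
have [c [_ cN aN]] := actw_pX e N N.
have := aN 1 _ _ p1 k1 (act_p_deltaX e (dexp e)) (act_kappa_deltaX (dexp e)).
rewrite !mul1r -exprM => /act_pair pN.
rewrite {1}/pair_mon exprSr (act_p_mon e N.+1) (pairZr pr) pN.
rewrite eAZ -pscaleAl eAZ 2!eAM eA_mon subnn eqxx !eAX (eA_delta A_bialg).
by rewrite !expr1n !mulr1 cN // mulrA.
Qed.

(** Between consecutive multiples of p the factor in [pair_monS] depends only on the residue mod p,
    so each block repeats the first one. All values thus reduce to those prescribed by
    [pairing_values]. *)
Lemma pair_monD e t n : (n < p)%N ->
  pair_mon e (t * p + n) = pair_mon e (t * p) * pair_mon e n.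
Proof.
elim: n => [|n ih] np; first by rewrite addn0 pair_mon0 mulr1.
rewrite addnS !pair_monS ih 1?ltnW // -addnS /mon_coef modnMDl modn_small //=.
have -> : q ^+ (dexp e * (t * p + n)) = q ^+ (dexp e * n).
  by rewrite mulnDr exprD mulnA mulnC exprM qXp expr1n mul1r.
by rewrite mulrCA.
Qed.


Lemma pair_mon_small e n : (n < p)%N ->
  pair_mon e n = 'i ^+ n * pm e qh ^+ n * qfact q n.
Proof.
move=> np; have := pair_pe pair_val e np np; rewrite eqxx mulr1 => <-.
by rewrite /pair_mon /mon divn_small // modn_small // mul1r.
Qed.

Lemma pair_mon_mul e t : pair_mon e (t * p) = 'i ^+ t * t`!%:R.
Proof.
have := pair_Pz pair_val e t t; rewrite eqxx mulr1 => <-.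
by rewrite /pair_mon /PP -exprM [(p * t)%N]mulnC /mon mulnK // modnMl mulr1.
Qed.

Lemma pair_mon_eq e t n : (n < p)%N ->
  pair_mon e (t * p + n) =
  'i ^+ t * t`!%:R * ('i ^+ n * pm e qh ^+ n * qfact q n).
Proof. by move=> np; rewrite pair_monD // pair_mon_mul pair_mon_small. Qed.

Definition Ymon (N M k : nat) : U := P true ^+ N * P false ^+ M * kap ^+ k.

(** The factors act from the right: kappa^k, then p_-^M with mon true N' as outer factor, then
    p_+^N. The middle step leaves delta^(-M), written with exponent (p - 1) M; each of the N factors
    p_+ sees its eigenvalue q^(-M), whence q^(-NM). *)
Lemma pair_words N M k N' M' j :
  pair (Ymon N M k) (mon true N' * (mon false M' * delta ^+ j)) =
  pair_mon true N * pair_mon false M *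
  (q ^+ (j * (k + N + M)) * (q ^- (N * M))) *
  (N == N')%:R * (M == M')%:R.
Proof.
have [cN [cN0 cNV aN]] := actw_pX true N N'.
have [cM [cM0 cMV aM]] := actw_pX false M M'.
have kw : act kap (mon true N' * (mon false M' * delta ^+ j))
    (q ^+ j *: (mon true N' * (mon false M' * delta ^+ j))).
  apply: act_eq.
    apply: act_kappaM (act_kappa_mon true N') _.
    exact: act_kappaM (act_kappa_mon false M') (act_kappa_deltaX j).
  by rewrite -!pscaleAr.
have pM := aM _ _ _ (act_p_mon_neq false N') (act_kappa_mon true N')
  (act_p_deltaX false j) (act_kappa_deltaX j).
pose r := mon false (M' - M) * delta ^+ (dexp false * M + j).
have kr : act kap r (q ^+ (dexp false * M + j) *: r).
  apply: act_eq.
    exact: act_kappaM (act_kappa_mon false _) (act_kappa_deltaX _).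
  by rewrite -pscaleAr.
have p_r : act (P true) r 0.
  apply: act_eq.
    apply: act_pM (act_p_mon_neq true _) (act_p_deltaX true _).
      exact/act_kappaV_fix/act_kappa_mon.
    exact: act_kappa_deltaX.
  by rewrite mul0r mulr0 addr0.
have p1 : act (P true) 1 0.
  by apply: act_eq (act_one _) _; rewrite (eU_p U_bialg) scale0r.
have k1 : act kap 1 1.
  by apply: act_eq (act_one _) _; rewrite (eU_kappa U_bialg) scale1r.
have := aN 1 _ _ p1 k1 p_r kr; rewrite !mul1r => pN.
rewrite /Ymon (actX k kw) (pairZr pr) pM (pairZr pr) -pscaleAl -pscaleAr.
rewrite -[_ * _ * delta ^+ j]mulrA -exprD -/r (pairZr pr) (act_pair pN).
rewrite eAZ -pscaleAl eAZ 2!eAM eA_mon eAM eA_mon !eAX (eA_delta A_bialg).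
rewrite !expr1n !mulr1 !subn_eq0.
have -> : q ^- (N * M) = q ^+ (dexp false * M * N).
  by rewrite -mulnA [RHS]exprM /= expr_pred_order ?qXp // exprVn [(M * N)%N]mulnC.
(* The constant vanishes for N' < N, and the counit of mon true (N' - N) vanishes for N' > N; only
   N' = N is left. *)
have hN : cN * (N' <= N)%:R = pair_mon true N * (N == N')%:R.
  by case: (ltngtP N' N) => [/cN0->|_|/cNV->]; rewrite ?mul0r ?mulr0.
have hM : cM * (M' <= M)%:R = pair_mon false M * (M == M')%:R.
  by case: (ltngtP M' M) => [/cM0->|_|/cMV->]; rewrite ?mul0r ?mulr0.
transitivity (cN * (N' <= N)%:R * (cM * (M' <= M)%:R) *
    (q ^+ j ^+ k * q ^+ j ^+ M * q ^+ (dexp false * M + j) ^+ N)).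
  by ring.
rewrite hN hM -!exprM mulnDl !mulnDr !exprD; ring.
Qed.


(** * Discrete Fourier transform between the powers of [delta] and [zeta] *)

Lemma sum_root_of_unity (x : C) :
  x ^+ p = 1 -> \sum_(j < p) x ^+ j = p%:R * (x == 1)%:R.
Proof.
move=> xp; case: eqVneq => [->|x1].
  by rewrite mulr1; under eq_bigr do rewrite expr1n; rewrite sumr_const card_ord.
apply/eqP; have := subrX1 x p; rewrite xp subrr mulr0 => /esym/eqP.
by rewrite mulf_eq0 subr_eq0 (negbTE x1).
Qed.

Lemma root_orthogonality a b :
  \sum_(j < p) q ^- (j * a) * q ^+ (j * b) = p%:R * (b == a %[mod p])%:R.
Proof.
have qa : q ^+ a != 0 by rewrite expf_neq0 // q_neq0.
rewrite (eq_bigr (fun j : 'I_p => (q ^+ b / q ^+ a) ^+ j)) => [|j _].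
  rewrite sum_root_of_unity; last first.
    rewrite exprMn exprVn -!exprM ![(_ * p)%N]mulnC !exprM qXp.
    by rewrite !expr1n invr1 mulr1.
  by rewrite -(eq_prim_root_expr q_prim) -(inj_eq (mulIf qa)) divfK // mul1r.
by rewrite exprMn exprVn -!exprM ![(_ * j)%N]mulnC mulrC.
Qed.

Lemma p_neq0 : p%:R != 0 :> C.
Proof. by rewrite pnatr_eq0 -lt0n. Qed.

(** In [pair_words] the exponent j occurs only in q^(j(k+N+M)), so the Fourier sum defining zeta
    selects the residue class of k + N + M. *)
Lemma pair_words_zeta N M k N' M' l :
  pair (Ymon N M k) (mon true N' * (mon false M' * zeta p q l)) =
  pair_mon true N * pair_mon false M * q ^- (N * M) *
  (N == N')%:R * (M == M')%:R * (k + N + M == l %[mod p])%:R.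
Proof.
rewrite /zeta -!pscaleAr (pairZr pr) !mulr_sumr (pair_sumr pr).
under eq_bigr do rewrite -!pscaleAr (pairZr pr) pair_words.
set c := pair_mon _ _ * _ * _ * _ * _.
rewrite (eq_bigr (fun j : 'I_p => c * (q ^- (j * l) * q ^+ (j * (k + N + M))))).
  by rewrite -mulr_sumr root_orthogonality mulrCA mulKf // p_neq0.
by move=> j _; rewrite /c; ring.
Qed.

Lemma delta_zeta j : delta ^+ j = \sum_(l < p) q ^+ (j * l) *: zeta p q l.
Proof.
have jp : (j %% p < p)%N by rewrite ltn_mod.
under eq_bigr do rewrite scalerA mulrC -scalerA scaler_sumr.
rewrite -scaler_sumr exchange_big /=.
under eq_bigr => i _.
  under eq_bigr => l _ do rewrite scalerA mulrC [(i * l)%N]mulnC [(j * l)%N]mulnC.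
  rewrite -scaler_suml root_orthogonality -scalerA.
  over.
rewrite -scaler_sumr scalerA mulVf ?p_neq0 // scale1r.
rewrite (bigD1 (Ordinal jp)) //= modn_mod eqxx scale1r.
rewrite big1 ?addr0 => [|i]; first by rewrite expr_mod // deltaXp.
rewrite -val_eqE /= => ij.
by rewrite eq_sym (modn_small (ltn_ord i)) (negbTE ij) scale0r.
Qed.

Lemma zeta_mod l l' : l = l' %[mod p] -> zeta p q l = zeta p q l'.
Proof.
move=> ll; rewrite /zeta; congr (_ *: _); apply: eq_bigr => j _.
congr (_^-1 *: _); apply/eqP; rewrite (eq_prim_root_expr q_prim).
by rewrite -modnMmr ll modnMmr.
Qed.

Hypothesis qh_sqr : qh ^+ 2 = q.

Lemma qh_neq0 : qh != 0.
Proof. by have := q_neq0; rewrite -qh_sqr expf_eq0. Qed.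

Lemma pair_mon_neq0 e N : pair_mon e N != 0.
Proof.
have np := ltn_pmod N p_gt0.
rewrite (divn_eq N p) pair_mon_eq // !mulf_neq0 ?expf_neq0 ?neq0Ci //.
- by rewrite pnatr_eq0 -lt0n fact_gt0.
- exact/pm_neq0/qh_neq0.
- exact: qfact_neq0.
Qed.

(** * The dual bases *)

Local Notation index := (nat * nat * 'I_p)%type.

Definition dual_coef N M := pair_mon true N * pair_mon false M * q ^- (N * M).

Lemma dual_coef_neq0 N M : dual_coef N M != 0.
Proof.
by rewrite !mulf_neq0 ?pair_mon_neq0 // invr_neq0 // expf_neq0 // q_neq0.
Qed.

Definition Ybase (b : index) : U := Ymon b.1.1 b.1.2 b.2.
(** The index of zeta is shifted by N + M to make the pairing with [Ybase] diagonal. *)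
Definition ybase (b : index) : A := (dual_coef b.1.1 b.1.2)^-1 *:
  (mon true b.1.1 * (mon false b.1.2 * zeta p q (b.2 + b.1.1 + b.1.2))).

Lemma pair_base a b : pair (Ybase b) (ybase a) = (a == b)%:R.
Proof.
case: a b => [[N' M'] k'] [[N M] k].
rewrite /ybase (pairZr pr) pair_words_zeta /= -/(dual_coef N M) !xpair_eqE.
have [->|] := eqVneq N' N; last by rewrite !(mulr0, mul0r).
have [->|] := eqVneq M' M; last by rewrite !(mulr0, mul0r).
rewrite !mulr1 mulKf ?dual_coef_neq0 //= -!addnA eqn_modDr !modn_small //.
by rewrite eq_sym.
Qed.

Lemma Ymon_spanned N M k : spanned Ybase (Ymon N M k).
Proof.
have kp : (k %% p < p)%N by rewrite ltn_mod.
have -> : Ymon N M k = Ybase (N, M, Ordinal kp).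
  by rewrite /Ybase /Ymon /= kappaX_mod.
exact: spanned_base.
Qed.

Lemma Ybase_span u : spanned Ybase u.
Proof.
move: u; apply: presented_spanned => [|[e|] [[N M] k]].
- by have := Ymon_spanned 0 0 0; rewrite /Ymon !expr0 !mulr1.
- rewrite -/(pp p q e) /Ybase /Ymon /=; case: e.
    rewrite !mulrA -exprS; exact: Ymon_spanned.
  rewrite !mulrA (commrX N (pp_comm false true)) -[_ * _ * P false ^+ M]mulrA.
  by rewrite -exprS; exact: Ymon_spanned.
- rewrite -/(kappa p q) /Ybase /Ymon /=.
  rewrite !mulrA (skew_commuteXr N (kp_comm true)) -!pscaleAl -[_ * kap * _]mulrA.
  rewrite (skew_commuteXr M (kp_comm false)) -!pscaleAr -!pscaleAl !mulrA.
  rewrite -[_ * kap * _]mulrA -exprS.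
  do 2!apply: (linear_closedZ (spanned_linear_closed _)).
  exact: Ymon_spanned.
Qed.

Lemma mon_zeta_spanned N M l :
  spanned ybase (mon true N * (mon false M * zeta p q l)).
Proof.
(* This is l - (N + M) modulo p, which undoes the shift built into [ybase]. *)
have kp : ((l + p.-1 * (N + M)) %% p < p)%N by rewrite ltn_mod.
have -> : mon true N * (mon false M * zeta p q l) =
    dual_coef N M *: ybase (N, M, Ordinal kp).
  rewrite /ybase scalerA divff ?dual_coef_neq0 // scale1r /=.
  congr (_ * (_ * _)); apply: zeta_mod.
  by rewrite -addnA modnDml -addnA -mulSnr prednK // [in RHS]addnC mulnC modnMDl.
apply: linear_closedZ; [exact: spanned_linear_closed|exact: spanned_base].
Qed.

Lemma mon_delta_spanned N M j :
  spanned ybase (mon true N * (mon false M * delta ^+ j)).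
Proof.
rewrite delta_zeta !mulr_sumr.
apply: (linear_closed_sum (spanned_linear_closed _)) => l _.
rewrite -2!pscaleAr; apply: (linear_closedZ (spanned_linear_closed _)).
exact: mon_zeta_spanned.
Qed.

Lemma zM_mon e W : z e * mon e W = mon e (W + p).
Proof. by rewrite /mon mulrA -exprS divnDr // divnn p_gt0 addn1 modnDr. Qed.

Lemma etaM_mon e W : exists c, eta e * mon e W = c *: mon e W.+1.
Proof.
have zC u : u * z e = z e * u by rewrite z_central.
rewrite {1}/mon mulrA (commrX _ (zC _)) -mulrA -exprS.
have np := ltn_pmod W p_gt0.
have [np1|] := ltnP (W %% p).+1 p.
  by exists 1; rewrite scale1r [in RHS](divn_eq W p) -addnS monE.
rewrite leq_eqVlt ltnNge np orbF => /eqP pn.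
(* Here W + 1 is a multiple of p: the product contains eta_e^p = 0 although mon e (W + 1) is a power
   of z_e. *)
by exists 0; rewrite -pn etaXp mulr0 scale0r.
Qed.

Lemma eta_false_mon W :
  exists c, eta false * mon true W = c *: (mon true W * eta false).
Proof.
exists (q ^+ 2 ^+ (W %% p)).
have zC u : u * z true = z true * u by rewrite z_central.
by rewrite /mon mulrA (commrX _ (zC _)) -mulrA (skew_commuteXr _ eta_comm)
  -pscaleAr mulrA.
Qed.

Lemma delta_mon e W : exists c, delta * mon e W = c *: (mon e W * delta).
Proof.
exists (q ^- 2 ^+ (W %% p)).
have zC u : u * z e = z e * u by rewrite z_central.
by rewrite /mon mulrA (commrX _ (zC _)) -mulrA
  (skew_commuteXr _ (delta_eta_comm e)) -pscaleAr mulrA.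
Qed.

Lemma ybase_span v : spanned ybase v.
Proof.
have lc := spanned_linear_closed ybase.
have lZ c u : spanned ybase u -> spanned ybase (c *: u) by exact: linear_closedZ.
move: v; apply: presented_spanned => [|g [[N M] k]].
  by have := mon_delta_spanned 0 0 0; rewrite expr0 !mon0 !mulr1.
rewrite /ybase -pscaleAr; apply: (lZ) => /=.
move: (k + N + M)%N => l {k}.
rewrite /zeta -!pscaleAr !mulr_sumr; apply: (lZ).
apply: linear_closed_sum => // j _; rewrite -!pscaleAr; apply: (lZ).
case: g => [[]||[]].
- have [c h] := etaM_mon true N; rewrite -/(Defs.eta p q true) mulrA h -pscaleAl.
  exact/lZ/mon_delta_spanned.
- have [c h] := eta_false_mon N; have [d h'] := etaM_mon false M.
  rewrite -/(Defs.eta p q false) mulrA h -pscaleAl -mulrA [eta _ * _]mulrA h'.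
  by rewrite -!pscaleAl -!pscaleAr; apply/lZ/lZ/mon_delta_spanned.
- have [c h] := delta_mon true N; have [d h'] := delta_mon false M.
  rewrite -/(Defs.delta p q) mulrA h -pscaleAl -mulrA [delta * (_ * _)]mulrA h'.
  rewrite -!pscaleAl -!pscaleAr -mulrA -exprS.
  exact/lZ/lZ/mon_delta_spanned.
- by rewrite -/(Defs.z p q true) mulrA zM_mon; exact: mon_delta_spanned.
- rewrite -/(Defs.z p q false) mulrA z_central -mulrA [z _ * _]mulrA zM_mon.
  exact: mon_delta_spanned.
Qed.

Lemma base_dual : dual_bases pair Ybase ybase.
Proof.
apply: (dual_family_bases pl pr pair_base) => u; apply: spanned_family.
  exact: Ybase_span.
exact: ybase_span.
Qed.

(** * Expansion of the closed formula for T *)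

Lemma pm_exp e (x : C) n : pm e (x ^+ n) = pm e x ^+ n.
Proof. by case: e; rewrite //= exprVn. Qed.

(** Normal ordering (p_e kappa^(-1))^m produces the inverse of the power of q^(+-1) with exponent
    'C(m, 2) in the cut-off exponential, and i * (-q^(-+1/2)) is the inverse of i q^(+-1/2). What is
    left is the inverse of the pairing value. *)
Lemma cutoff_expE e :
  cutoff_exp e ('i *: (epsilon p q qh e ⊗ eta e)) =
  \sum_(m < p) (pair_mon e m)^-1 *: ((P e ^+ m * kapV ^+ m) ⊗ (eta e ^+ m)).
Proof.
apply: eq_bigr => m _; rewrite presented_exprZ tensX.
rewrite presented_exprZ (skew_exprM m (kV_comm e)).
rewrite !tensZl !scalerA pair_mon_small // pm_exp; congr (_ *: _).
have qe := pm_neq0 e q_neq0.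
have q2 : (pm e q)^-1 ^+ 'C(m, 2) * pm e q ^+ 'C(m, 2) = 1.
  by rewrite -exprMn mulVf // expr1n.
have iX : 'i ^+ m * (- (pm e qh)^-1) ^+ m = ('i ^+ m * pm e qh ^+ m)^-1.
  by rewrite -!exprMn mulrN -mulNr -invCi -invfM exprVn.
transitivity ((pm e q)^-1 ^+ 'C(m, 2) * pm e q ^+ 'C(m, 2) *
  ('i ^+ m * (- (pm e qh)^-1) ^+ m) / qfact q m); first by ring.
by rewrite q2 iX mul1r -invfM.
Qed.

Lemma sum_periodic (V : zmodType) (F : nat -> V) c :
  (forall k, F (k + p)%N = F k) -> \sum_(k < p) F (k + c)%N = \sum_(k < p) F k.
Proof.
move=> Fp; elim: c => [|c ih]; first by apply: eq_bigr => k _; rewrite addn0.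
rewrite -ih -(big_mkord xpredT (fun k => F (k + c.+1)%N)).
rewrite -(big_mkord xpredT (fun k => F (k + c)%N)).
under eq_bigr do rewrite -addSnnS.
rewrite -(big_add1 _ _ 0 p.+1 xpredT (fun k => F (k + c)%N)).
rewrite big_nat_recr ?p_gt0 //= [in RHS]big_ltn //.
by rewrite addrC addnC Fp.
Qed.

Lemma DmatE : Dmat p q = \sum_(k < p) (kap ^+ k) ⊗ (zeta p q k).
Proof.
rewrite /Dmat scaler_sumr; apply: eq_bigr => k _.
rewrite /zeta tensZr tens_sumr; congr (_ *: _); apply: eq_bigr => j _.
by rewrite tensZr mulnC.
Qed.

Lemma kV_kappa c : kapV ^+ c * kap ^+ c = 1.
Proof.
rewrite /kappaV -exprM -exprD -{2}[c]mul1n -mulnDl addn1 prednK // exprM.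
by rewrite kappaXp expr1n.
Qed.

(** Reindexing k as k + c over the residues mod p. In this way the factors kappa^(-1) of the
    epsilons turn into the index shift of zeta. *)
Lemma Dmat_shift c : ((kapV ^+ c) ⊗ 1) * Dmat p q =
  \sum_(k < p) (kap ^+ k) ⊗ (zeta p q (k + c)).
Proof.
pose F k : UA p q := (kapV ^+ c * kap ^+ k) ⊗ (zeta p q k).
rewrite DmatE mulr_sumr (eq_bigr (fun k : 'I_p => F k)) => [|k _]; last first.
  by rewrite tensM mul1r.
rewrite -(@sum_periodic _ F c) => [|k]; last first.
  by rewrite /F exprD kappaXp mulr1 (@zeta_mod (k + p) k) ?modnDr.
apply: eq_bigr => k _; rewrite /F addnC exprD mulrA kV_kappa mul1r.
by rewrite addnC.
Qed.

Lemma sum_triangle (V : zmodType) (G : nat -> nat -> V) L :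
  \sum_(l < L) \sum_(t < l.+1) G t (l - t)%N =
  \sum_(t < L) \sum_(s < L - t) G t s.
Proof.
elim: L => [|L ih]; first by rewrite !big_ord0.
rewrite [LHS]big_ord_recr /= ih.
rewrite [RHS](eq_bigr (fun t : 'I_L.+1 =>
    \sum_(s < L - t) G t s + G t (L - t)%N)) => [|t _].
  rewrite big_split /=; congr (_ + _).
  by rewrite big_ord_recr /= subnn big_ord0 addr0.
by rewrite subSn -1?ltnS // big_ord_recr.
Qed.

(** A truncated exponential of a sum does not factor: the truncation by total degree leaves the
    triangle t + s < L, which is also how [base_index] is cut. *)
Lemma exp_partial_comm L (a b : UA p q) : a * b = b * a ->
  exp_partial L (a + b) =
  \sum_(t < L) \sum_(s < L - t) (t`!%:R^-1 * s`!%:R^-1) *: (a ^+ t * b ^+ s).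
Proof.
move=> ab.
rewrite -(sum_triangle (fun t s => (t`!%:R^-1 * s`!%:R^-1) *: (a ^+ t * b ^+ s))).
apply: eq_bigr => l _; rewrite addrC exprDn_comm //.
rewrite scaler_sumr; apply: eq_bigr => t _; have tl : (t <= l)%N by rewrite -ltnS.
rewrite -scaler_nat scalerA.
have -> : b ^+ (l - t) * a ^+ t = a ^+ t * b ^+ (l - t).
  by apply: commrX; apply: esym; apply: commrX.
congr (_ *: _).
have nz n : n`!%:R != 0 :> C by rewrite pnatr_eq0 -lt0n fact_gt0.
apply: (mulfI (nz l)); rewrite mulVKf //.
apply: (mulIf (nz t)); apply: (mulIf (nz (l - t)%N)).
rewrite -[LHS]mulrA -!natrM bin_fact //; field.
by rewrite !nz.
Qed.

Lemma PP_mon e t : PP p q e ^+ t = P e ^+ (t * p).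
Proof. by rewrite /PP -exprM mulnC. Qed.

Lemma exp_partialE L :
  exp_partial L (- 'i *: (PP p q true ⊗ z true) -
                 'i *: (PP p q false ⊗ z false)) =
  \sum_(t < L) \sum_(s < L - t)
    (pair_mon true (t * p) * pair_mon false (s * p))^-1 *:
      ((PP p q true ^+ t * PP p q false ^+ s) ⊗ (z true ^+ t * z false ^+ s)).
Proof.
rewrite -scaleNr exp_partial_comm.
  apply: eq_bigr => t _; apply: eq_bigr => s _.
  rewrite !presented_exprZ !tensX presented_scaleM tensM scalerA !pair_mon_mul.
  by rewrite -!invCi !exprVn !invfM; congr (_ *: _); ring.
rewrite !presented_scaleM !tensM mulrC [z true * _]z_central; congr (_ *: (_ ⊗ _)).
exact/commrX/commr_sym/commrX/pp_comm.
Qed.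

(** The bounding box K p for N and M follows from the filter condition, so the list contains every
    index satisfying it. *)
Definition base_index K : seq index :=
  [seq b <- [seq (NM, k) | NM <- [seq (N, M) | N <- index_iota 0 (K * p),
                                               M <- index_iota 0 (K * p)],
                           k <- enum 'I_p]
    | (b.1.1 %/ p + b.1.2 %/ p < K)%N].

Lemma base_index_uniq K : uniq (base_index K).
Proof.
apply/filter_uniq/allpairs_uniq; last by move=> [? ?] [? ?] _ _ [-> ->].
  by apply: allpairs_uniq; rewrite ?iota_uniq // => -[? ?] [? ?] _ _ [-> ->].
exact: enum_uniq.
Qed.

Lemma mem_base_index K (b : index) :
  (b \in base_index K) = (b.1.1 %/ p + b.1.2 %/ p < K)%N.
Proof.
rewrite mem_filter andb_idr // => bK; case: b bK => [[N M] k] /= bK.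
apply: allpairs_f; last exact: mem_enum.
by apply: allpairs_f; rewrite mem_index_iota /= -ltn_divLR //;
  apply: leq_ltn_trans bK; [exact: leq_addr|exact: leq_addl].
Qed.

Lemma sum_mulp (V : zmodType) (F : nat -> V) K :
  \sum_(N < K * p) F N = \sum_(t < K) \sum_(n < p) F (t * p + n)%N.
Proof.
elim: K => [|K ih]; first by rewrite !big_ord0.
by rewrite mulSnr big_split_ord ih [RHS]big_ord_recr.
Qed.

Lemma sum_base_index (V : zmodType) (F : index -> V) K :
  \sum_(b <- base_index K) F b =
  \sum_(t < K) \sum_(s < K - t) \sum_(n < p) \sum_(m < p) \sum_(k < p)
    F ((t * p + n)%N, (s * p + m)%N, k).
Proof.
rewrite big_filter big_mkcond !big_allpairs /=.
pose G N M := \sum_(k < p)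
  (if (N %/ p + M %/ p < K)%N then F (N, M, k) else 0).
transitivity (\sum_(N < K * p) \sum_(M < K * p) G N M).
  rewrite big_mkord; apply: eq_bigr => N _.
  by rewrite big_mkord; apply: eq_bigr => M _; rewrite big_enum.
rewrite (sum_mulp (fun N => \sum_(M < K * p) G N M)); apply: eq_bigr => t _ /=.
under eq_bigr => n _ do rewrite (sum_mulp (fun M => G (t * p + n)%N M)).
rewrite exchange_big /=.
rewrite (big_ord_widen K (fun s => \sum_(n < p) \sum_(m < p) \sum_(k < p)
  F ((t * p + n)%N, (s * p + m)%N, k))) ?leq_subr // [RHS]big_mkcond.
apply: eq_bigr => s _; rewrite ltn_subRL.
case: ifP => ts.
  apply: eq_bigr => n _; apply: eq_bigr => m _; apply: eq_bigr => k _.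
  by rewrite !divnMDl // !divn_small // !addn0 ts.
apply: big1 => n _; apply: big1 => m _; apply: big1 => k _.
by rewrite !divnMDl // !divn_small // !addn0 ts.
Qed.


Definition canonical_sum K : UA p q := \sum_(b <- base_index K) Ybase b ⊗ ybase b.

(** Only kappa^(-n) has to cross p_-^m; the resulting q^(nm) is the inverse of the factor q^(-nm) in
    [dual_coef]. *)
Lemma term_U t s n m :
  PP p q true ^+ t * PP p q false ^+ s * (P true ^+ n * kapV ^+ n) *
    (P false ^+ m * kapV ^+ m) =
  q ^+ (n * m) *: (P true ^+ (t * p + n) * P false ^+ (s * p + m) * kapV ^+ (n + m)).
Proof.
rewrite !mulrA -[_ * kapV ^+ n * _]mulrA (skew_commuteX n m (kV_comm false)).
rewrite -pscaleAr -pscaleAl /= invrK; congr (_ *: _).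
rewrite !PP_mon !exprD !mulrA; do 2!congr (_ * _).
rewrite -!mulrA; congr (_ * _); rewrite !mulrA; congr (_ * _).
exact/commrX/commr_sym/commrX/pp_comm.
Qed.

Lemma term_A t s n m (u : A) : (n < p)%N -> (m < p)%N ->
  z true ^+ t * z false ^+ s * eta true ^+ n * eta false ^+ m * u =
  mon true (t * p + n) * (mon false (s * p + m) * u).
Proof.
move=> np mp; rewrite !monE // !mulrA; do 2!congr (_ * _).
rewrite -!mulrA; congr (_ * _).
have zC v : v * z false = z false * v by rewrite z_central.
by rewrite (commrX s (zC _)).
Qed.

(** An exact equality for each L. All powers of kappa^(-1) are collected next to [Dmat], which
    absorbs them; each summand then matches one basis tensor, since q and zeta see t p + n and s p +
    m only modulo p. *)
Lemma universal_T_partial L :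
  exp_partial L (- 'i *: (PP p q true ⊗ z true) -
                 'i *: (PP p q false ⊗ z false)) *
    cutoff_exp true ('i *: (epsilon p q qh true ⊗ eta true)) *
    cutoff_exp false ('i *: (epsilon p q qh false ⊗ eta false)) *
    Dmat p q = canonical_sum L.
Proof.
rewrite exp_partialE !cutoff_expE /canonical_sum sum_base_index.
move: (Dmat p q) Dmat_shift => D Dshift.
rewrite !mulr_suml; apply: eq_bigr => t _.
rewrite !mulr_suml; apply: eq_bigr => s _.
rewrite [RHS]exchange_big mulr_sumr !mulr_suml; apply: eq_bigr => m _ /=.
rewrite mulr_sumr !mulr_suml; apply: eq_bigr => n _.
rewrite !presented_scaleM !tensM term_U tensZl -!pscaleAl scalerA.
set X := P true ^+ _ * _; set y := z true ^+ _ * _ * _ * _.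
have -> : (X * kapV ^+ (n + m)) ⊗ y = (X ⊗ y) * ((kapV ^+ (n + m)) ⊗ 1).
  by rewrite tensM mulr1.
rewrite -[X ⊗ y * _ * D]mulrA Dshift mulr_sumr scaler_sumr.
apply: eq_bigr => k _; rewrite tensM /y term_A // /ybase tensZr /=.
have -> : zeta p q (k + (n + m)) = zeta p q (k + (t * p + n) + (s * p + m)).
  apply: zeta_mod; rewrite -!addnA -modnDmr -[in RHS]modnDmr; congr ((_ + _) %% _)%N.
  by rewrite modnMDl addnCA modnMDl.
congr (_ *: _); rewrite /dual_coef !pair_monD //.
have -> : q ^- ((t * p + n) * (s * p + m)) = q ^- (n * m).
  congr (_^-1); apply/eqP; rewrite (eq_prim_root_expr q_prim).
  by rewrite -modnMm !modnMDl modnMm.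
by rewrite !invfM invrK; ring.
Qed.

(** * The pairing formula on monomials *)

Lemma PP_word t s n m :
  PP p q true ^+ t * PP p q false ^+ s * P true ^+ n * P false ^+ m =
  P true ^+ (t * p + n) * P false ^+ (s * p + m).
Proof.
rewrite !PP_mon !exprD !mulrA; congr (_ * _); rewrite -!mulrA; congr (_ * _).
exact/commrX/commr_sym/commrX/pp_comm.
Qed.

Lemma eqn_mulpD t n t' n' : (n < p)%N -> (n' < p)%N ->
  (t * p + n == t' * p + n')%N = (t == t') && (n == n').
Proof.
move=> np n'p; apply/eqP/andP => [tn|[/eqP-> /eqP->] //].
have /(congr1 (divn ^~ p)) := tn; rewrite !divnMDl // !divn_small // !addn0 => ->.
by have /(congr1 (modn ^~ p)) := tn; rewrite !modnMDl !modn_small // => ->.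
Qed.

Lemma pair_monomials (n m k n' m' k' : 'I_p) (t s t' s' : nat) :
  pair (PP p q true ^+ t * PP p q false ^+ s *
          P true ^+ n * P false ^+ m * kap ^+ k)
       (z true ^+ t' * z false ^+ s' *
          eta true ^+ n' * eta false ^+ m' * zeta p q k') =
    'i ^+ (n + m + t + s) * (qh ^+ n / qh ^+ m) * q ^- (n * m) *
    t`!%:R * s`!%:R * qfact q n * qfact q m *
    (n == n')%:R * (m == m')%:R * (t == t')%:R * (s == s')%:R *
    (k + n + m == k' %[mod p])%:R.
Proof.
rewrite PP_word term_A // -/(Ymon _ _ _) pair_words_zeta !pair_mon_eq //=.
have -> : q ^- ((t * p + n) * (s * p + m)) = q ^- (n * m).
  congr (_^-1); apply/eqP; rewrite (eq_prim_root_expr q_prim).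
  by rewrite -modnMm !modnMDl modnMm.
have -> : k + (t * p + n) + (s * p + m) = k + n + m %[mod p].
  rewrite -!addnA -modnDmr -[in RHS]modnDmr; congr ((_ + _) %% _)%N.
  by rewrite modnMDl addnCA modnMDl.
rewrite !eqn_mulpD // -!mulnb !natrM !exprD exprVn -!val_eqE /=; ring.
Qed.

(** * Convergence to the universal element *)

Lemma word_peel (R : pzRingType) (f : bool -> R) t s K : (K < t + s)%N ->
  exists (e : bool) (t' s' : nat), (K <= t' + s')%N /\
    f true ^+ t * f false ^+ s = f e * (f true ^+ t' * f false ^+ s').
Proof.
case: t => [|t].
  case: s => // s Ks; exists false, 0%N, s; split=> //.
  by rewrite expr0 !mul1r exprS.
by move=> Ks; exists true, t, s; split=> //; rewrite exprS mulrA.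
Qed.

(** One factor P_e and one factor z_e' are peeled off on the left at a time. Their signs may differ,
    and P_e (x) z_e' is a generator of the ideal in every case. *)
Lemma ideal_exp_words K t s t' s' (u : U) (a : A) :
  (K <= t + s)%N -> (K <= t' + s')%N ->
  ideal_exp (@Pz_ideal C p q) K ((PP p q true ^+ t * PP p q false ^+ s * u)
    ⊗ (z true ^+ t' * z false ^+ s' * a)).
Proof.
elim: K t s t' s' => // K ih t s t' s'.
move=> /(word_peel (PP p q))[e [t1 [s1 [h1 ->]]]].
move=> /(word_peel (fun e => z e))[e' [t2 [s2 [h2 ->]]]].
rewrite -mulrA -[_ * _ * a]mulrA -tensM; apply: ideal_expSl; last exact: ih.
by apply: ideal_gen_base; exists e, e'.
Qed.

Lemma ideal_exp_base K b b' :
  b \notin base_index K -> b' \notin base_index K ->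
  ideal_exp (@Pz_ideal C p q) K (Ybase b ⊗ ybase b').
Proof.
case: b b' => [[N M] k] [[N' M'] k']; rewrite !mem_base_index -!leqNgt /= => bK bK'.
rewrite /ybase tensZr.
apply: (linear_closedZ (ideal_exp_linear_closed _ _)) => /=.
rewrite /Ybase /Ymon /= (divn_eq N p) (divn_eq M p) -PP_word.
rewrite (divn_eq N' p) (divn_eq M' p) -term_A ?ltn_mod // -!mulrA.
rewrite [X in X ⊗ _]mulrA [X in _ ⊗ X]mulrA.
exact: ideal_exp_words.
Qed.

Lemma universal_T_dual : is_universal_T pair (fun L =>
    exp_partial L (- 'i *: (PP p q true ⊗ z true) -
                 'i *: (PP p q false ⊗ z false)) *
    cutoff_exp true ('i *: (epsilon p q qh true ⊗ eta true)) *
    cutoff_exp false ('i *: (epsilon p q qh false ⊗ eta false)) *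
    Dmat p q).
Proof.
split; first by exists index, Ybase, ybase; exact: base_dual.
move=> I X x dXx K.
have [S0 hS0] := canonical_element_approx pl pr dXx base_dual
  (base_index_uniq K) (ideal_exp_linear_closed _ _) (@ideal_exp_base K).
(* The threshold K suffices for L: the partial sum of order K is the canonical element cut at t + s
   < K. *)
exists S0, K => S L uS S0S KL; have := hS0 S uS S0S.
rewrite -/(canonical_sum K) -universal_T_partial.
set w := (- 'i *: _ - _ : UA p q).
move: (cutoff_exp true _) (cutoff_exp false _) => cp cm hK.
have Jw : ideal_gen (fun w : UA p q => exists e e', w = PP p q e ⊗ z e') w.
  rewrite /w; apply: ideal_add; rewrite -?scaleNr -[_ *: _]mul1r -pscaleAr pscaleAl.
    by apply/ideal_genMl/ideal_gen_base; exists true, true.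
  by apply/ideal_genMl/ideal_gen_base; exists false, false.
(* The error splits at the partial sum of order K. The first part is covered by [hK]; the second is
   a tail of the exponential, whose terms contain w^K with w in the ideal. *)
rewrite -[_ - _](subrKA (exp_partial K w * cp * cm * Dmat p q)).
apply: ideal_expD => //; rewrite -!mulrBl; do 3!apply: ideal_expMr.
rewrite /exp_partial -(subnKC KL) big_split_ord /= opprD addrA subrr sub0r.
apply: ideal_expN; apply: (linear_closed_sum (ideal_exp_linear_closed _ _)) => l _.
apply: (linear_closedZ (ideal_exp_linear_closed _ _)).
by rewrite exprD; apply/ideal_expMr/ideal_expX.
Qed.

End Pairing.
Theorem proposition1 (C : numClosedFieldType) (p : nat) (q qh : C)
    (p_ge3 : (3 <= p)%N) (p_odd : odd p) (q_prim : p.-primitive_root q)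
    (qh_sqr : qh ^+ 2 = q) (qh_p : qh ^+ p = -1)
    (DU : Uq p q -> tensor (Uq_rel p q) (Uq_rel p q)) (eU : Uq p q -> C)
    (DA : Aq p q -> tensor (Aq_rel p q) (Aq_rel p q)) (eA : Aq p q -> C)
    (U_bialg : Uq_bialgebra DU eU) (A_bialg : Aq_bialgebra DA eA)
    (pair : Uq p q -> Aq p q -> C)
    (pair_hopf : hopf_pairing DU eU DA eA pair)
    (pair_val : pairing_values qh pair) :
  (forall (n m k n' m' k' : 'I_p) (t s t' s' : nat),
     pair (PP p q true ^+ t * PP p q false ^+ s *
             pp p q true ^+ n * pp p q false ^+ m * kappa p q ^+ k)
          (z p q true ^+ t' * z p q false ^+ s' *
             eta p q true ^+ n' * eta p q false ^+ m' * zeta p q k') =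
       'i ^+ (n + m + t + s) * (qh ^+ n / qh ^+ m) * q ^- (n * m) *
       t`!%:R * s`!%:R * qfact q n * qfact q m *
       (n == n')%:R * (m == m')%:R * (t == t')%:R * (s == s')%:R *
       (k + n + m == k' %[mod p])%:R)
  /\
  is_universal_T pair (fun L =>
    exp_partial L (- 'i *: (PP p q true ⊗ z p q true)
                   - 'i *: (PP p q false ⊗ z p q false)) *
    cutoff_exp true ('i *: (epsilon p q qh true ⊗ eta p q true)) *
    cutoff_exp false ('i *: (epsilon p q qh false ⊗ eta p q false)) *
    Dmat p q).
Proof.
split.
  exact: (pair_monomials p_ge3 q_prim U_bialg A_bialg pair_hopf pair_val).
exact: (universal_T_dual p_ge3 p_odd q_prim U_bialg A_bialg pair_hopf pair_val
  qh_sqr).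
Qed.
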